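(* Let $k\ge 3$ and $m\ge 1$ be integers, let $0<\varepsilon,\alpha<1$, and let $F$ be a $k$-partite $k$-graph each of whose $k$ parts has exactly $m$ vertices. Then there exist $n_0\in\mathbb{N}$ and $\mu>0$ such that the following holds for every $n\ge n_0$ with $m\mid n$: if $H$ is a $(\frac12+\varepsilon,\mu)$-dense $k$-partite $k$-graph each of whose parts has exactly $n$ vertices and $\delta'_{k-1}(H)\ge \alpha n$, then $H$ contains an $F$-factor.
   Context: A $k$-graph $H$ has a vertex set $V(H)$ and an edge set $E(H)$ consisting of $k$-element subsets of $V(H)$. A $k$-partite $k$-graph comes with a fixed partition $V(H)=V_1\cup\dots\cup V_k$ (its parts) such that every edge meets each $V_i$ in at most one vertex. A set $S\subseteq V(H)$ is legal if $|S\cap V_i|\le 1$ for all $i$. For $S\subseteq V(H)$ with $|S|=s<k$, $\deg_H(S)$ is the number of $(k-s)$-sets $S'$ with $S\cup S'\in E(H)$. The partite minimum $s$-degree $\delta'_s(H)$ is the minimum of $\deg_H(S)$ over all legal $s$-subsets $S$ of $V(H)$. A $k$-partite $k$-graph $H$ with parts $V_1,\dots,V_k$ and $N=|V(H)|$ vertices is $(p,\mu)$-dense if for all $X_1\subseteq V_1,\dots,X_k\subseteq V_k$ we have $e_H(X_1,\dots,X_k)\ge p|X_1|\cdots|X_k|-\mu N^k$, where $e_H(X_1,\dots,X_k)$ is the number of $(x_1,\dots,x_k)\in X_1\times\dots\times X_k$ with $\{x_1,\dots,x_k\}\in E(H)$. An $F$-factor in $H$ is a set of pairwise vertex-disjoint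 subgraphs of $H$, each isomorphic to $F$, whose vertex sets together cover $V(H)$. *)

(* Defs.v *)
From HB Require Import structures.
From mathcomp Require Import all_boot all_order all_algebra.
From mathcomp Require Import reals.
Set Implicit Arguments. Unset Strict Implicit. Unset Printing Implicit Defensive.
Import Order.TTheory GRing.Theory Num.Theory.
Local Open Scope ring_scope.

(* A k-partite k-graph is given by a finite vertex type T, a part map
   [part : T -> 'I_k] (so V_i = [set x | part x == i]) and an edge set
   [E : {set {set T}}]. *)

Definition legal (k : nat) (T : finType) (part : T -> 'I_k) (S : {set T}) : bool :=
  [forall i : 'I_k, #|[set x in S | part x == i]| <= 1]%N.

Definition is_kpartite_kgraph (k : nat) (T : finType) (part : T -> 'I_k)
    (E : {set {set T}}) : bool :=
  [forall e in E, (#|e| == k) && legal part e].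

Definition parts_of_size (k : nat) (T : finType) (part : T -> 'I_k) (n : nat) : bool :=
  [forall i : 'I_k, #|[set x : T | part x == i]| == n].

Definition deg (k : nat) (T : finType) (E : {set {set T}}) (S : {set T}) : nat :=
  #|[set S' : {set T} | (#|S'| == k - #|S|)%N && (S :|: S' \in E)]|.

Definition partite_mindeg_ge (R : realType) (k : nat) (T : finType)
    (part : T -> 'I_k) (E : {set {set T}}) (s : nat) (c : R) : Prop :=
  forall S : {set T}, legal part S -> #|S| = s -> c <= (deg k E S)%:R.

Definition e_H (k : nat) (T : finType) (E : {set {set T}}) (X : 'I_k -> {set T}) : nat :=
  #|[set f : {ffun 'I_k -> T} |
      [forall i, f i \in X i] && ([set f i | i : 'I_k] \in E)]|.

Definition pmu_dense (R : realType) (k : nat) (T : finType) (part : T -> 'I_k)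
    (E : {set {set T}}) (p mu : R) : Prop :=
  forall X : 'I_k -> {set T},
    (forall i, X i \subset [set x | part x == i]) ->
    p * \prod_(i < k) (#|X i|%:R : R) - mu * (#|T|%:R) ^+ k <= (e_H E X)%:R.

Definition embeds (TF T : finType) (EF : {set {set TF}}) (E : {set {set T}})
    (phi : TF -> T) : Prop :=
  injective phi /\ forall e, e \in EF -> phi @: e \in E.

Definition has_F_factor (TF T : finType) (EF : {set {set TF}}) (E : {set {set T}}) : Prop :=
  exists (r : nat) (phi : 'I_r -> TF -> T),
    (forall j, embeds EF E (phi j)) /\
    (forall x : T, exists! j : 'I_r, exists y : TF, phi j y = x).

(* Main.v *)
(* Only complete tiles K(m,...,m) are needed. Density gives one inside any linear
   balanced set of vertices, so a greedy tiling stops with at most a small linear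
   balanced remainder L, and L must be absorbed by a set reserved beforehand.
   For x, y in the same part V_i, call a word s a swap if both x :: s and y :: s
   can be tiled. Whenever the links of x and y share a positive proportion of
   their edges, blowing up the edges through this intersection gives a positive
   proportion of swaps. By the codegree condition every x shares a positive
   proportion of its link with linearly many x' in V_i; by density > 1/2, the
   links of x' and y' from two linear subsets of V_i have average proportion above
   1/2, so a positive proportion of the pairs have intersecting links. Hence every x, y are joined by many
   paths x - x' - y' - y, and swaps along such a path compose. A tile together with
   swaps between its vertices and those of Q absorbs Q. Disjoint absorbers serving
   all Q at once are picked greedily with an exponential potential, in place of a
   random choice and a Chernoff bound. *)
Require Import Defs.
From HB Require Import structures.
From mathcomp Require Import all_boot all_order all_algebra.
From mathcomp Require Import boolp reals.
From mathcomp Require Import zify ring lra.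
Import Order.TTheory GRing.Theory Num.Theory.
Set Implicit Arguments. Unset Strict Implicit. Unset Printing Implicit Defensive.
Local Open Scope ring_scope.

(** * Averages over words *)

Section Blowup.
Variable T : eqType.

(* The vertices of a word that is a homomorphic copy of the complete k-partite
   k-graph with parts of size m, the i-th part being the i-th block. *)
Fixpoint blowup (m k : nat) (G : pred (seq T)) (s : seq T) : bool :=
  if k is k'.+1
  then blowup m k' (fun v => all (fun a => G (a :: v)) (take m s)) (drop m s)
  else G [::].

Lemma blowup_choice (x0 : T) m k G s (phi : nat -> nat) : size s = (k * m)%N ->
  blowup m k G s -> (forall i, (i < k)%N -> (phi i < m)%N) ->
  G (mkseq (fun i => nth x0 s (i * m + phi i)) k).
Proof.
elim: k G s phi => [|k IH] G s phi //= sz bl phim.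
have szd : size (drop m s) = (k * m)%N by rewrite size_drop sz mulSn addKn.
have /allP := IH _ _ (phi \o S) szd bl (fun i ik => phim i.+1 ik).
have p0 := phim 0%N isT.
move/(_ (nth x0 s (phi 0%N))).
rewrite -(nth_take x0 p0) mem_nth; last first.
  by rewrite size_take sz mulSn; case: ifP => //; lia.
move=> /(_ isT); rewrite /mkseq /= mul0n add0n nth_take //; apply: etrans.
congr (G (_ :: _)); rewrite (iotaDl 1 0) -map_comp; apply: eq_map => i /=.
by rewrite nth_drop mulSn addnA.
Qed.

End Blowup.

Section Average.
Variable R : realFieldType.

Definition avg (A : finType) (f : A -> R) : R := #|A|%:R^-1 * \sum_a f a.

Lemma eq_avg (A : finType) (f g : A -> R) : f =1 g -> avg f = avg g.
Proof. by move=> fg; rewrite /avg (eq_bigr g). Qed.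

Lemma ler_avg (A : finType) (f g : A -> R) :
  (forall a, f a <= g a) -> avg f <= avg g.
Proof. by move=> fg; rewrite ler_wpM2l ?invr_ge0 ?ler0n // ler_sum. Qed.

Lemma avgD (A : finType) (f g : A -> R) :
  avg (fun a => f a + g a) = avg f + avg g.
Proof. by rewrite /avg big_split mulrDr. Qed.

Lemma avgMl (A : finType) c (f : A -> R) : avg (fun a => c * f a) = c * avg f.
Proof. by rewrite /avg -mulr_sumr mulrCA. Qed.

Lemma avgMr (A : finType) c (f : A -> R) : avg (fun a => f a * c) = avg f * c.
Proof. by rewrite mulrC -avgMl; apply: eq_avg => a; rewrite mulrC. Qed.

Lemma avg_cst (A : finType) c : (0 < #|A|)%N -> avg (fun _ : A => c) = c.
Proof.
by move=> A0; rewrite /avg sumr_const -(mulr_natl c); apply: mulKf; rewrite pnatr_eq0 -lt0n.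
Qed.

Lemma avg_ge0 (A : finType) (f : A -> R) : (forall a, 0 <= f a) -> 0 <= avg f.
Proof. by move=> f0; rewrite mulr_ge0 ?invr_ge0 ?ler0n // sumr_ge0. Qed.

Lemma avg_exchange (A B : finType) (f : A -> B -> R) :
  avg (fun a => avg (f a)) = avg (fun b => avg (fun a => f a b)).
Proof. by rewrite /avg -!mulr_sumr exchange_big mulrCA. Qed.

Lemma avg_pred (A : finType) (P : pred A) :
  avg (fun a => (P a)%:R) = #|P|%:R / #|A|%:R.
Proof. by rewrite /avg -natr_sum -big_mkcond sum1_card mulrC. Qed.

(** Convexity of the power function: its graph lies above the tangent at [a]. Multiplying the
    inductive bound by [t] exceeds the next tangent by (M+1) a^M (t-a)^2. *)
Lemma tangent_pow (M : nat) (a t : R) : 0 <= a -> 0 <= t ->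
  a ^+ M.+1 + M.+1%:R * a ^+ M * (t - a) <= t ^+ M.+1.
Proof.
move=> a0 t0; elim: M => [|M IH]; first by rewrite !expr1 expr0; lra.
have := ler_wpM2l t0 IH; rewrite -exprS; apply: le_trans; rewrite -subr_ge0.
suff -> : t * (a ^+ M.+1 + M.+1%:R * a ^+ M * (t - a)) -
    (a ^+ M.+2 + M.+2%:R * a ^+ M.+1 * (t - a)) =
    M.+1%:R * a ^+ M * (t - a) ^+ 2.
  by rewrite mulr_ge0 ?sqr_ge0 // mulr_ge0 ?ler0n // exprn_ge0.
by rewrite !exprS -(natr1 M.+1); ring.
Qed.

(** Jensen's inequality for powers: average the tangent bound taken at the mean of [f], where the
    linear term averages to zero. *)
Lemma avg_pow (A : finType) (M : nat) (f : A -> R) : (0 < #|A|)%N ->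
  (forall a, 0 <= f a) -> avg f ^+ M <= avg (fun a => f a ^+ M).
Proof.
move=> A0 f0; case: M => [|M]; first by rewrite expr0 avg_cst.
have m0 := avg_ge0 f0.
apply: le_trans (ler_avg (fun a => tangent_pow M m0 (f0 a))).
by rewrite avgD avg_cst // avgMl avgD avg_cst // subrr mulr0 addr0.
Qed.

Lemma exists_le_avg (A : finType) (f : A -> R) : (0 < #|A|)%N ->
  exists a, f a <= avg f.
Proof.
move=> A0; case/card_gt0P: (A0) => a0 _.
have [/existsP//|/existsPn H] := boolP [exists a, f a <= avg f].
suff: avg f < avg f by rewrite ltxx.
rewrite {2}/avg ltr_pdivlMl ?ltr0n // mulr_natl -sumr_const.
by apply: ltr_sum; [by apply/hasP; exists a0; rewrite ?mem_index_enum|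
  move=> a _; rewrite ltNge H].
Qed.

End Average.

Section TupleAverage.
Variables (R : realFieldType) (T : finType).
Hypothesis T_gt0 : (0 < #|T|)%N.
Implicit Types (f g : seq T -> R).

(* Averages over words of length b; f is a function on all sequences so that
   words can be cut and concatenated without casts. *)
Definition Ex (b : nat) f : R := avg (fun t : b.-tuple T => f t).

Lemma tuple_gt0 b : (0 < #|{: b.-tuple T}|)%N.
Proof. by rewrite card_tuple expn_gt0 T_gt0. Qed.

Lemma eq_Ex b f g : (forall s, size s = b -> f s = g s) -> Ex b f = Ex b g.
Proof. by move=> fg; apply: eq_avg => t; rewrite fg ?size_tuple. Qed.

Lemma ler_Ex b f g : (forall s, size s = b -> f s <= g s) -> Ex b f <= Ex b g.
Proof. by move=> fg; apply: ler_avg => t; rewrite fg ?size_tuple. Qed.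

Lemma ExD b f g : Ex b (fun s => f s + g s) = Ex b f + Ex b g.
Proof. exact: avgD. Qed.

Lemma ExMl b c f : Ex b (fun s => c * f s) = c * Ex b f.
Proof. exact: avgMl. Qed.

Lemma ExMr b c f : Ex b (fun s => f s * c) = Ex b f * c.
Proof. exact: avgMr. Qed.

Lemma Ex_cst b c : Ex b (fun=> c) = c.
Proof. by apply: avg_cst; apply: tuple_gt0. Qed.

Lemma Ex_ge0 b f : (forall s, 0 <= f s) -> 0 <= Ex b f.
Proof. by move=> f0; apply: avg_ge0. Qed.

Lemma Ex_exchange a b (h : seq T -> seq T -> R) :
  Ex a (fun s => Ex b (h s)) = Ex b (fun u => Ex a (fun s => h s u)).
Proof. exact: avg_exchange. Qed.

Lemma Ex_avg (A : finType) b (h : seq T -> A -> R) :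
  Ex b (fun s => avg (h s)) = avg (fun a => Ex b (fun s => h s a)).
Proof. exact: avg_exchange. Qed.

Lemma Ex_pow b M f : (forall s, 0 <= f s) -> Ex b f ^+ M <= Ex b (fun s => f s ^+ M).
Proof. by move=> f0; apply: avg_pow => //; apply: tuple_gt0. Qed.

Lemma exists_le_Ex b f : exists2 s, size s = b & f s <= Ex b f.
Proof.
have [t Ht] := exists_le_avg (fun t : b.-tuple T => f t) (tuple_gt0 b).
by exists t => //; apply: size_tuple.
Qed.

Lemma Ex0 f : Ex 0 f = f [::].
Proof.
rewrite (eq_Ex (g := fun=> f [::])) ?Ex_cst // => s.
by move/size0nil->.
Qed.

Lemma sum_tupleS b (F : seq T -> R) :
  \sum_(t : b.+1.-tuple T) F t = \sum_x \sum_(t : b.-tuple T) F (x :: t).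
Proof.
rewrite pair_big /=.
rewrite (reindex (fun p : T * b.-tuple T => [tuple of p.1 :: p.2])) //=.
exists (fun t : b.+1.-tuple T => (thead t, [tuple of behead t])).
  by case=> x t _; rewrite /= theadE; congr pair; apply: val_inj.
by move=> t _; rewrite [RHS]tuple_eta; apply: val_inj.
Qed.

Lemma Ex_cons b f : Ex b.+1 f = avg (fun x => Ex b (fun s => f (x :: s))).
Proof.
rewrite /Ex /avg (sum_tupleS _ f) -mulr_sumr mulrA; congr (_ * _).
by rewrite !card_tuple expnS natrM invfM.
Qed.

Lemma Ex_cat a b f : Ex (a + b) f = Ex a (fun s => Ex b (fun u => f (s ++ u))).
Proof.
elim: a f => [|a IH] f; first by rewrite Ex0.
by rewrite addSn !Ex_cons; apply: eq_avg => x; rewrite IH.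
Qed.

Lemma Ex1 f : Ex 1 f = avg (fun x => f [:: x]).
Proof. by rewrite Ex_cons; apply: eq_avg => x; rewrite Ex0. Qed.

Lemma Ex_all m (P : pred T) :
  Ex m (fun s => (all P s)%:R) = avg (fun x => (P x)%:R) ^+ m.
Proof.
elim: m => [|m IH]; first by rewrite Ex0.
rewrite Ex_cons exprS -IH -avgMr; apply: eq_avg => x.
by rewrite -ExMl; apply: eq_Ex => s _ /=; rewrite -natrM mulnb.
Qed.

Lemma point_le_Ex b f s : (forall u, 0 <= f u) -> size s = b ->
  f s <= #|T|%:R ^+ b * Ex b f.
Proof.
move=> f0 /eqP sb; rewrite /Ex /avg card_tuple natrX mulVKf; last first.
  by rewrite expf_neq0 // pnatr_eq0 -lt0n.
by rewrite (bigD1 (Tuple sb)) //= lerDl sumr_ge0.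
Qed.

Lemma avg_mem_le (s : seq T) : avg (fun x => (x \in s)%:R) <= (size s)%:R / #|T|%:R :> R.
Proof.
rewrite avg_pred ler_wpM2r ?invr_ge0 ?ler0n // ler_nat.
exact: card_size.
Qed.

Lemma Ex_has_le b (W : seq T) :
  Ex b (fun s => (has (mem W) s)%:R) <= b%:R * ((size W)%:R / #|T|%:R) :> R.
Proof.
elim: b => [|b IH]; first by rewrite Ex0 mul0r.
rewrite Ex_cons -natr1 mulrDl mul1r.
apply: le_trans (_ : avg (fun x => (x \in W)%:R + Ex b (fun s => (has (mem W) s)%:R)) <= _).
  apply: ler_avg => x; rewrite -[X in X + _](Ex_cst b) -ExD.
  apply: ler_Ex => s _ /=.
  by case: (x \in W); case: (has _ s); rewrite /= ?addr0 ?add0r ?lerDl ?ler01.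
by rewrite avgD avg_cst // addrC lerD // avg_mem_le.
Qed.

(** Union bound over pairs of positions. Repetitions in words of fixed length are thus negligible
    for large [T], so densities can be computed for words with repeated letters. *)
Lemma Ex_nuniq_le b : Ex b (fun s => (~~ uniq s)%:R) <= b%:R ^+ 2 / #|T|%:R :> R.
Proof.
elim: b => [|b IH]; first by rewrite Ex0 expr0n mul0r.
rewrite Ex_cons.
apply: le_trans (_ : avg (fun x => Ex b (fun s => (x \in s)%:R + (~~ uniq s)%:R)) <= _).
  apply: ler_avg => x; apply: ler_Ex => s _ /=.
  by case: (x \in s); case: (uniq s); rewrite /= ?addr0 ?add0r ?lerDl ?ler01.
under eq_avg do rewrite ExD.
rewrite avgD avg_cst // -Ex_avg.
apply: le_trans (lerD (ler_Ex (g := fun=> b%:R / #|T|%:R) _) IH) _.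
  by move=> s <-; apply: avg_mem_le.
rewrite Ex_cst -mulrDl ler_wpM2r ?invr_ge0 ?ler0n //.
by rewrite -natrX -natrD -natrX ler_nat -(addn1 b) sqrnD; lia.
Qed.

(* Blowing up one coordinate at a time, each step is an instance of Jensen's
   inequality. *)
Lemma blowup_avg m k (G : pred (seq T)) :
  Ex k (fun v => (G v)%:R) ^+ (m ^ k) <=
  Ex (k * m) (fun s => (blowup m k G s)%:R).
Proof.
elim: k G => [|k IH] G; first by rewrite mul0n !Ex0 expr1.
rewrite mulSn Ex_cat.
pose Gr r v := all (fun a => G (a :: v)) r.
rewrite [leRHS](eq_Ex (g := fun r => Ex (k * m) (fun s => (blowup m k (Gr r) s)%:R))); last first.
  move=> r rm; apply: eq_Ex => s _ /=.
  by rewrite take_size_cat // drop_size_cat.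
apply: le_trans (ler_Ex (fun r _ => IH (Gr r))).
apply: le_trans (Ex_pow _ _ _); last by move=> r; apply: Ex_ge0 => v.
rewrite Ex_exchange expnS exprM.
rewrite lerXn2r ?nnegrE ?exprn_ge0 ?Ex_ge0 // => [v|]; first exact: Ex_ge0.
(* For fixed [v] the [m] letters of the first block are independent, which produces the power [m];
   Jensen over [v] then moves it outside. *)
apply: le_trans (ler_Ex (f := fun v => avg (fun a => (G (a :: v))%:R) ^+ m) _); last first.
  by move=> v _; rewrite Ex_all.
apply: le_trans (Ex_pow _ _ _); last by move=> v; apply: avg_ge0.
by rewrite Ex_cons Ex_avg.
Qed.

Lemma Ex_sum_tuple b (P : pred (seq T)) :
  #|T|%:R ^+ b * Ex b (fun s => (P s)%:R) = #|[set t : b.-tuple T | P t]|%:R :> R.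
Proof.
rewrite /Ex avg_pred card_tuple natrX mulrC divfK; last first.
  by rewrite expf_neq0 // pnatr_eq0 -lt0n.
by rewrite cardsE.
Qed.

(** Resampling one letter of a uniform word leaves the word uniform. This is how averages over edges
    are split into averages over links. *)
Lemma Ex_set_nth (x0 : T) k i f : (i < k)%N ->
  Ex k f = avg (fun x => Ex k (fun v => f (set_nth x0 v i x))).
Proof.
move=> ik; have -> : k = (i + (1 + (k - i.+1)))%N by lia.
rewrite -Ex_avg Ex_cat [RHS]Ex_cat.
apply: eq_Ex => s si; rewrite Ex_cat [RHS]Ex_cat !Ex1.
rewrite [RHS](eq_avg (g := fun=> avg (fun x => Ex (k - i.+1) (fun u => f (s ++ x :: u))))).
  by rewrite avg_cst.
move=> y; rewrite Ex_avg; apply: eq_avg => x; apply: eq_Ex => u _; congr f.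
rewrite set_nthE ifT ?take_size_cat //; last by rewrite !size_cat si /=; lia.
by rewrite drop_cat si ltnNge leqnSn /= subSnn /= drop0.
Qed.

Lemma Ex_drop1 f b p : (p < b.+1)%N ->
  Ex b.+1 (fun s => f (take p s ++ drop p.+1 s)) = Ex b f.
Proof.
move=> pb; have -> : b.+1 = (p + (1 + (b - p)))%N by lia.
rewrite Ex_cat.
transitivity (Ex (p + (b - p)) f); last by congr Ex; lia.
rewrite Ex_cat.
apply: eq_Ex => s si; rewrite Ex_cat Ex1 (eq_avg (g := fun=> Ex (b - p) (fun u => f (s ++ u)))).
  by rewrite avg_cst.
move=> y; apply: eq_Ex => u _; congr f.
by rewrite take_size_cat // drop_cat si ltnNge leqnSn /= subSnn /= drop0.
Qed.

End TupleAverage.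
Lemma ler_pow (R : realDomainType) n (x y : R) :
  0 <= x -> x <= y -> x ^+ n <= y ^+ n.
Proof. by move=> x0 xy; rewrite lerXn2r ?nnegrE // (le_trans x0). Qed.

(** * Tilings and absorbers *)

Section SeqFacts.

Lemma extract_pattern (T S : eqType) (f : T -> S) (c : seq S) (L : seq T) :
  (forall i, (count_mem i c <= count (fun x => f x == i) L)%N) ->
  exists Q L', map f Q = c /\ perm_eq L (Q ++ L').
Proof.
elim: c L => [|i c IH] L H; first by exists [::], L; rewrite perm_refl.
have /hasP[x xL /eqP fx] : has (fun x => f x == i) L.
  by rewrite has_count; apply: leq_trans (H i); rewrite /= eqxx.
have pL := perm_to_rem xL.
case: (IH (rem x L)) => [j|Q [L' [fQ pQ]]].
  have := H j; rewrite (permP pL (fun x => f x == j)) /= fx.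
  by rewrite leq_add2l.
exists (x :: Q), L'; split; first by rewrite /= fx fQ.
by rewrite (perm_trans pL) //= perm_cons.
Qed.

Lemma uniq_flatten_nth (T : eqType) (ss : seq (seq T)) (x : T) i j :
  uniq (flatten ss) -> x \in nth [::] ss i -> x \in nth [::] ss j -> i = j.
Proof.
elim: ss i j => [|s ss IH] [|i] [|j] //=; rewrite cat_uniq => /and3P[_ /hasPn H U].
- move=> xs xj; suff /H /negP[] : x \in flatten ss by [].
  apply/flattenP; exists (nth [::] ss j) => //; apply: mem_nth.
  by rewrite ltnNge; apply/negP => /(nth_default [::]) E; rewrite E in xj.
- move=> xi xs; suff /H /negP[] : x \in flatten ss by [].
  apply/flattenP; exists (nth [::] ss i) => //; apply: mem_nth.
  by rewrite ltnNge; apply/negP => /(nth_default [::]) E; rewrite E in xi.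
- by move=> xi xj; rewrite (IH i j).
Qed.

Lemma count_divn m k i : (0 < m)%N ->
  count_mem i [seq (p %/ m)%N | p <- iota 0 (k * m)] = if (i < k)%N then m else 0%N.
Proof.
move=> m0; elim: k => [|k IH]; first by rewrite mul0n.
rewrite mulSnr iotaD map_cat count_cat IH add0n.
have -> : [seq (p %/ m)%N | p <- iota (k * m) m] = nseq m k.
  apply: (@eq_from_nth _ 0%N); rewrite ?size_map ?size_iota ?size_nseq // => a am.
  by rewrite (nth_map 0%N) ?size_iota // nth_iota // nth_nseq am divnMDl // divn_small // addn0.
rewrite count_nseq ltnS [(i <= k)%N]leq_eqVlt /= eq_sym.
by case: eqVneq => [->|_]; rewrite ?ltnn /= ?mul1n ?mul0n ?add0n ?addn0.
Qed.

End SeqFacts.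

Section Tilings.
Variables (k m : nat) (T : finType) (part : T -> 'I_k) (E : {set {set T}}).
Variable x0 : T.

Definition pt (x : T) : nat := part x.
Definition trans (v : seq T) : bool := map pt v == iota 0 k.
Definition edge (v : seq T) : bool := trans v && ([set x in v] \in E).
(* The parts met by a tile, position by position. *)
Definition pat : seq nat := [seq (p %/ m)%N | p <- iota 0 (k * m)].

(** Letters of one block may coincide, so that the density of tiles is a plain instance of the
    blow-up inequality. Distinctness is recovered from repetition-free words. *)
Definition tile (t : seq T) : Prop :=
  size t = (k * m)%N /\
  forall phi : nat -> nat, (forall i, (i < k)%N -> (phi i < m)%N) ->
    edge (mkseq (fun i => nth x0 t (i * m + phi i)) k).

Definition tiled (s : seq T) : Prop :=
  exists2 ts, (forall t, t \in ts -> tile t) & perm_eq s (flatten ts).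

Lemma trans_size v : trans v -> size v = k.
Proof. by move=> /eqP/(congr1 size); rewrite size_map size_iota. Qed.

Lemma tiled_nil : tiled [::].
Proof. by exists [::]. Qed.

Lemma tile_tiled t : tile t -> tiled t.
Proof.
move=> tt; exists [:: t]; last by rewrite /= cats0.
by move=> u; rewrite inE => /eqP->.
Qed.

Lemma tiled_perm s s' : perm_eq s s' -> tiled s -> tiled s'.
Proof.
move=> ss [ts tts p]; exists ts => //.
by apply: perm_trans p; rewrite perm_sym.
Qed.

Lemma tiled_cat s s' : tiled s -> tiled s' -> tiled (s ++ s').
Proof.
move=> [ts H p] [ts' H' p']; exists (ts ++ ts'); last by rewrite flatten_cat perm_cat.
by move=> t; rewrite mem_cat => /orP[/H|/H'].
Qed.

Lemma tiled_flatten ss : (forall s, s \in ss -> tiled s) -> tiled (flatten ss).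
Proof.
elim: ss => [|s ss IH] H; first exact: tiled_nil.
apply: tiled_cat; first by apply: H; rewrite inE eqxx.
by apply: IH => u us; apply: H; rewrite inE us orbT.
Qed.

Definition swap (x y : T) (s : seq T) : Prop := tiled (x :: s) /\ tiled (y :: s).

(** With [x] present, [s1], [s2], [s3] are completed by [x], [x'], [y']; with [y] present, by [x'],
    [y'], [y]. Either way both inner vertices are used exactly once. *)
Lemma swap_chain x x' y' y s1 s2 s3 :
  swap x x' s1 -> swap x' y' s2 -> swap y' y s3 ->
  swap x y ([:: x'; y'] ++ s1 ++ s2 ++ s3).
Proof.
move=> [a1 b1] [a2 b2] [a3 b3]; split.
- apply: tiled_perm (tiled_cat a1 (tiled_cat a2 a3)).
  by apply/permP => P; rewrite /= !count_cat /= !count_cat /=; lia.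
- apply: tiled_perm (tiled_cat b1 (tiled_cat b2 b3)).
  by apply/permP => P; rewrite /= !count_cat /= !count_cat /=; lia.
Qed.

Fixpoint swaps (c : nat) (ps : seq (T * T)) (s : seq T) : Prop :=
  if ps is p :: ps' then swap p.1 p.2 (take c s) /\ swaps c ps' (drop c s)
  else s = [::].

Lemma swaps_tiled c ps s : swaps c ps s ->
  tiled (unzip1 ps ++ s) /\ tiled (unzip2 ps ++ s).
Proof.
elim: ps s => [|[x y] ps IH] s /=; first by move=> ->; split; apply: tiled_nil.
case=> -[tx ty] /IH [t1 t2]; split.
- apply: tiled_perm (tiled_cat tx t1); rewrite /= perm_cons -{3}(cat_take_drop c s).
  by rewrite perm_catCA.
- apply: tiled_perm (tiled_cat ty t2); rewrite /= perm_cons -{3}(cat_take_drop c s).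
  by rewrite perm_catCA.
Qed.

Definition absorbs (Q A : seq T) : Prop := tiled A /\ tiled (Q ++ A).

(** Without [Q], the swap words are completed by the letters of [t]; with [Q], they are completed by
    the letters of [Q], and [t] is a tile by itself. *)
Lemma swaps_absorbs c t Q s : tile t -> size Q = size t ->
  swaps c (zip t Q) s -> absorbs Q (t ++ s).
Proof.
move=> tt QT /swaps_tiled; rewrite unzip1_zip ?unzip2_zip ?QT // => -[t1 t2].
split=> //; apply: tiled_perm (tiled_cat (tile_tiled tt) t2).
by rewrite perm_catCA.
Qed.

(** Greedy matching: using up one absorber lowers each count by at most one, and one fewer [Q]
    remains to be served. *)
Lemma absorb_all (AA Qs : seq (seq T)) :
  (forall A, A \in AA -> tiled A) ->
  (forall Q, Q \in Qs -> (size Qs <= count (fun A => `[< absorbs Q A >]) AA)%N) ->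
  tiled (flatten AA ++ flatten Qs).
Proof.
elim: Qs AA => [|Q Qs IH] AA HA HQ.
  by rewrite cats0; apply: tiled_flatten.
have /hasP[A AAA /asboolP[_ QA]] : has (fun A => `[< absorbs Q A >]) AA.
  by rewrite has_count; apply: leq_trans (HQ Q _); rewrite // inE eqxx.
have pA := perm_to_rem AAA.
have := IH (rem A AA); case=> [B /mem_rem/HA //|Q' Q'Qs|ts Hts pts].
  have := HQ Q'; rewrite inE Q'Qs orbT => /(_ isT).
  by rewrite (permP pA) /=; case: asbool; lia.
apply: tiled_perm (tiled_cat QA _); last by exists ts; first exact: Hts; exact: pts.
have /permP pf := perm_flatten pA.
apply/permP => P; rewrite !count_cat pf /= !count_cat.
by rewrite [(count P Q + _)%N]addnC -!addnA; congr addn; rewrite addnCA.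
Qed.

Hypothesis m_gt0 : (0 < m)%N.

Lemma tile_pat t : tile t -> map pt t = pat.
Proof.
case=> st H; apply: (@eq_from_nth _ 0%N); first by rewrite !size_map size_iota.
move=> p; rewrite size_map st => pk.
rewrite (nth_map x0) ?st // (nth_map 0%N) ?size_iota // nth_iota // add0n.
have dk : (p %/ m < k)%N by rewrite ltn_divLR.
have /H/andP[/eqP + _] : forall i, (i < k)%N -> (p %% m < m)%N.
  by move=> i _; rewrite ltn_mod.
move/(congr1 (fun l => nth 0%N l (p %/ m))).
rewrite (nth_map x0) ?size_mkseq // nth_mkseq // nth_iota // add0n => <-.
by rewrite -divn_eq.
Qed.

Lemma count_pat i : (i < k)%N -> count_mem i pat = m.
Proof. by move=> ik; rewrite count_divn // ik. Qed.

Lemma count_pt_pat s i : map pt s = pat -> (i < k)%N ->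
  count (fun x => pt x == i) s = m.
Proof. by move=> sp ik; rewrite -(count_pat ik) -sp count_map. Qed.

Lemma tiled_count s : tiled s ->
  exists c, forall i, (i < k)%N -> count (fun x => pt x == i) s = (c * m)%N.
Proof.
case=> ts H p; exists (size ts) => i ik; rewrite (permP p _) {p}.
elim: ts H => [|t ts IH] H //=.
rewrite count_cat IH; last by move=> u us; apply: H; rewrite inE us orbT.
by rewrite count_pt_pat // tile_pat //; apply: H; rewrite inE eqxx.
Qed.

Lemma split_balanced r L :
  (forall i, (i < k)%N -> count (fun x => pt x == i) L = (r * m)%N) ->
  exists Qs, [/\ size Qs = r, forall Q, Q \in Qs -> map pt Q = pat &
                 perm_eq L (flatten Qs)].
Proof.
elim: r L => [|r IH] L HL.
  exists [::]; split=> //=; case: L HL => // x L /(_ (pt x) (ltn_ord _)).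
  by rewrite /= eqxx.
case: (@extract_pattern _ _ pt pat L) => [i|Q [L' [ptQ pQ]]].
  rewrite /pat count_divn //; case: ifP => // ik.
  by rewrite HL // mulSn leq_addr.
case: (IH L') => [i ik|Qs [sQ HQ pL]].
  have := HL i ik; rewrite (permP pQ) count_cat (count_pt_pat ptQ ik) mulSn.
  exact: addnI.
exists (Q :: Qs); split; first by rewrite /= sQ.
  by move=> Q'; rewrite inE => /orP[/eqP->|/HQ].
by rewrite (perm_trans pQ) //= perm_cat2l.
Qed.

End Tilings.

(** * From a tiling of all vertices to an F-factor *)

Section Factor.
Variables (k m : nat) (T : finType) (part : T -> 'I_k) (E : {set {set T}}).
Hypothesis m_gt0 : (0 < m)%N.
Variable x0 : T.
Variables (TF : finType) (partF : TF -> 'I_k) (EF : {set {set TF}}).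
Hypothesis EF_kpartite : is_kpartite_kgraph partF EF.
Hypothesis partF_size : parts_of_size partF m.

Let cls (i : 'I_k) : seq TF := enum [set y | partF y == i].
Let pos (y : TF) : nat := index y (cls (partF y)).

Lemma size_cls i : size (cls i) = m.
Proof. by rewrite -cardE; apply/eqP; apply: (forallP partF_size). Qed.

Lemma pos_lt y : (pos y < m)%N.
Proof. by rewrite -(size_cls (partF y)) index_mem mem_enum inE. Qed.

Definition code (y : TF) : nat := (partF y * m + pos y)%N.

Lemma code_lt y : (code y < k * m)%N.
Proof.
have := ltn_ord (partF y); have := pos_lt y; rewrite /code; nia.
Qed.

Lemma code_inj : injective code.
Proof.
move=> y z yz.
have pyz : partF y = partF z.
  apply: val_inj => /=; have := congr1 (divn^~ m) yz.
  by rewrite /code !divnMDl // !divn_small ?pos_lt // !addn0.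
move: yz; rewrite /code /pos pyz => /addnI.
by apply: (index_inj y); rewrite mem_enum inE ?pyz.
Qed.

Lemma code_surj p : (p < k * m)%N -> exists y, code y = p.
Proof.
move=> pk; have ik : (p %/ m < k)%N by rewrite ltn_divLR.
set i := Ordinal ik.
have pm : (p %% m < size (cls i))%N by rewrite size_cls ltn_mod.
have [y0 _] : exists y, y \in cls i by case: (cls i) pm => // y l; exists y; rewrite inE eqxx.
exists (nth y0 (cls i) (p %% m)).
have yi : partF (nth y0 (cls i) (p %% m)) = i.
  by have := mem_nth y0 pm; rewrite mem_enum inE => /eqP.
by rewrite /code /pos yi index_uniq // ?enum_uniq // -divn_eq.
Qed.

(** An edge has [k] vertices and at most one in each of the [k] parts, so the part map is injective
    on it and, by counting, onto. *)
Lemma edge_transversal e : e \in EF ->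
  {in e &, injective partF} /\ forall i, exists2 y, y \in e & partF y = i.
Proof.
move=> eE; have := forallP EF_kpartite e; rewrite eE /= => /andP[/eqP ek /forallP le].
have inj : {in e &, injective partF}.
  move=> y z ye ze yz; have /card_le1_eqP := le (partF z).
  by apply; rewrite !inE ?ye ?ze /= ?yz eqxx.
split=> // i.
have : partF @: e = [set: 'I_k].
  by apply/eqP; rewrite eqEcard subsetT cardsT card_ord (card_in_imset inj) ek leqnn.
by move=> /setP/(_ i); rewrite inE => /imsetP[y ye ->]; exists y.
Qed.

Lemma tile_embeds t : uniq t -> tile m part E x0 t ->
  embeds EF E (fun y => nth x0 t (code y)).
Proof.
move=> ut [st H]; split=> [y z /eqP|e eE].
  by rewrite nth_uniq ?st ?code_lt // => /eqP/code_inj.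
have [inj surj] := edge_transversal eE.
(* The choice that selects the image of [e] in the tile. Since [e] meets every part, the default 0
   does not occur for [i < k]. *)
pose phi i := if [pick y in e | partF y == i :> nat] is Some y then pos y else 0%N.
have phiE y : y \in e -> phi (partF y) = pos y.
  move=> ye; rewrite /phi; case: pickP => [z /andP[ze /eqP zy]|/(_ y)].
    by congr pos; apply: inj => //; apply: val_inj.
  by rewrite /= ye eqxx.
have /H/andP[_] : forall i, (i < k)%N -> (phi i < m)%N.
  by move=> i _; rewrite /phi; case: pickP => [z _|_]; rewrite ?pos_lt.
congr (_ \in E); apply/setP => x; rewrite inE.
apply/mapP/imsetP => [[i]|[y ye ->]].
  rewrite mem_iota => ik ->; have [y ye yi] := surj (Ordinal ik).
  by exists y => //; rewrite /code -(phiE y ye) yi.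
by exists (partF y : nat); rewrite ?mem_iota //= phiE.
Qed.

Lemma tiled_has_F_factor : tiled m part E x0 (enum T) -> has_F_factor EF E.
Proof.
case=> ts Hts pts.
have uts : uniq (flatten ts) by rewrite -(perm_uniq pts) enum_uniq.
have tts (j : 'I_(size ts)) : tile m part E x0 (nth [::] ts j).
  by apply: Hts; apply: mem_nth.
exists (size ts), (fun j y => nth x0 (nth [::] ts j) (code y)); split=> [j|x].
  apply: tile_embeds; last exact: tts.
  have : nth [::] ts j \in ts by apply: mem_nth.
  move: (nth _ ts j) => u.
  move: uts; elim: (ts) => //= t l IH; rewrite cat_uniq => /and3P[ut _ ul].
  by rewrite inE => /orP[/eqP->|/IH->].
have : x \in flatten ts by rewrite -(perm_mem pts) mem_enum.
case/flattenP => t /(nthP [::])[j jts <-] xt.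
have [st _] := tts (Ordinal jts).
exists (Ordinal jts); split=> [|j' [y yx]].
  have [|y Ey] := @code_surj (index x (nth [::] ts j)).
    by rewrite -st index_mem.
  by exists y; rewrite Ey nth_index.
apply: val_inj => /=; apply: (uniq_flatten_nth uts xt).
by rewrite -yx; apply: mem_nth; have [-> _] := tts j'; apply: code_lt.
Qed.

End Factor.

(** * Density of swaps and absorbers *)

Section Constants.
Variables (R : realFieldType) (k m : nat) (eps alpha : R).
Local Notation kappa := (k%:R^-1 : R).

(** The first factor bounds the link of a vertex from below, the second is the codegree proportion;
    the product bounds the average of [link2] over its second vertex. *)
Definition nbr_const : R := alpha * kappa ^+ k * (alpha * kappa).
(** The squared factor comes from the two outer steps of a path x - x' - y' - y, the last factor
    from the middle step, averaged over neighbours x' of x and y' of y. *)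
Definition swap_const : R :=
  ((nbr_const / 2 * (alpha * kappa)) ^+ (m ^ k)) ^+ 2 *
  (eps * kappa ^+ k.-1 * (nbr_const / 2) ^+ 2 * (alpha * kappa)) ^+ (m ^ k).
Definition swap_size : nat := 2 + ((k * m).-1 + ((k * m).-1 + (k * m).-1)).
Definition absorb_const : R := (kappa ^+ k / 2) ^+ (m ^ k) * swap_const ^+ (k * m).
Definition absorb_size : nat := k * m + k * m * swap_size.

Hypotheses (k_gt0 : (0 < k)%N) (eps_gt0 : 0 < eps) (alpha_gt0 : 0 < alpha).

Lemma kappa_gt0 : 0 < kappa.
Proof. by rewrite invr_gt0 ltr0n. Qed.

Lemma nbr_const_gt0 : 0 < nbr_const.
Proof. by rewrite !mulr_gt0 ?exprn_gt0 ?kappa_gt0. Qed.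

Lemma swap_const_gt0 : 0 < swap_const.
Proof.
have k0 := kappa_gt0; have c0 := nbr_const_gt0.
have c2 : 0 < nbr_const / 2 by lra.
have ak0 : 0 < alpha * kappa by rewrite mulr_gt0.
by rewrite /swap_const; do ![done | apply: mulr_gt0 | apply: exprn_gt0].
Qed.

Lemma absorb_const_gt0 : 0 < absorb_const.
Proof.
have k0 : 0 < kappa ^+ k by rewrite exprn_gt0 // kappa_gt0.
by rewrite mulr_gt0 ?exprn_gt0 ?swap_const_gt0 //; lra.
Qed.

End Constants.

(** * Greedy choice of an absorbing family by an exponential potential *)

Section AbsorbingFamily.
Variables (R : realFieldType) (T : finType) (b l : nat).
Variables (V good : pred (seq T)) (Ab : seq T -> pred (seq T)) (beta : R).
Hypotheses (T0 : (0 < #|T|)%N) (beta_le1 : beta <= 1).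
Hypothesis Ab_good : forall Q A, V Q -> Ab Q A -> good A.
Hypothesis Ab_dense : forall Q, V Q -> beta <= Ex b (fun A => (Ab Q A)%:R).

(* If some Q met at most h members of AA, its single term would already exceed the
   bound on Phi obtained after q * h steps. *)
Let Phi (AA : seq (seq T)) : R :=
  Ex l (fun Q => (V Q)%:R * 2^-1 ^+ count (Ab Q) AA).

Let admissible (AA : seq (seq T)) :=
  uniq (flatten AA) /\ forall A, A \in AA -> size A = b /\ good A.

Lemma size_flatten_admissible AA : admissible AA -> size (flatten AA) = (b * size AA)%N.
Proof.
case=> _; elim: AA => [|A AA IH] H; first by rewrite muln0.
rewrite /= size_cat IH => [|B BAA]; last by apply: H; rewrite inE BAA orbT.
by have [-> _] := H A (mem_head _ _); rewrite mulnS.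
Qed.

(** A random word absorbs a given [Q] with probability at least [beta]; repeated letters and
    collisions with [AA] cost at most [beta / 4] each. With the remaining probability [beta / 2] the
    term of [Q] is halved, and some word does at least as well as the average. *)
Lemma absorbing_step AA : admissible AA ->
  b%:R ^+ 2 / #|T|%:R <= beta / 4 ->
  b%:R * ((b * size AA)%:R / #|T|%:R) <= beta / 4 ->
  exists AA', [/\ admissible AA', (size AA' <= (size AA).+1)%N &
    Phi AA' <= (1 - beta / 4) * Phi AA].
Proof.
move=> adm b2 bW; pose W := flatten AA.
pose ok A := [&& uniq A, ~~ has (mem W) A & good A].
pose next A := if ok A then A :: AA else AA.
have key : Ex b (fun A => Phi (next A)) <= (1 - beta / 4) * Phi AA.
  rewrite /Phi Ex_exchange -ExMl; apply: ler_Ex => Q _.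
  rewrite ExMl [leRHS]mulrCA; case VQ : (V Q); rewrite ?mul0r // !mul1r.
  rewrite (eq_Ex (g := fun A => 2^-1 ^+ count (Ab Q) AA *
      (1 + - 2^-1 * (ok A && Ab Q A)%:R))); last first.
    move=> A _; rewrite /next; case: (ok A) => /=; last by rewrite mulr0 addr0 mulr1.
    by rewrite exprD mulrC; congr (_ * _); case: (Ab Q A) => /=; lra.
  rewrite ExMl mulrC ler_wpM2r ?exprn_ge0 ?invr_ge0 ?ler0n //.
  rewrite ExD Ex_cst // ExMl.
  have : beta <= Ex b (fun A => (ok A && Ab Q A)%:R) +
      (Ex b (fun A : seq T => (~~ uniq A)%:R) + Ex b (fun A => (has (mem W) A)%:R)).
    apply: le_trans (Ab_dense VQ) _; rewrite -!ExD; apply: ler_Ex => A _.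
    case AQ : (Ab Q A); last by rewrite !addr_ge0 ?ler0n.
    rewrite /ok (Ab_good VQ AQ) !andbT; case: (uniq A); case: (has _ A) => /=; lra.
  have := Ex_nuniq_le R T0 b; have := Ex_has_le R T0 b W.
  rewrite (size_flatten_admissible adm); lra.
have [A sA HA] := exists_le_Ex T0 b (fun A => Phi (next A)).
exists (next A); split; last exact: le_trans HA key.
  rewrite /next; case okA : (ok A) => //; have /and3P[uA hA gA] := okA.
  have [uW HW] := adm; split=> [|B]; first by rewrite /= cat_uniq uA has_sym hA.
  by rewrite inE => /orP[/eqP->|/HW].
by rewrite /next; case: ifP.
Qed.

Lemma absorbing_family (q h : nat) :
  b%:R ^+ 2 / #|T|%:R <= beta / 4 ->
  b%:R * ((b * (q * h))%:R / #|T|%:R) <= beta / 4 ->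
  (1 - beta / 4) ^+ q <= 4^-1 ->
  (#|T| ^ l < 2 ^ h)%N ->
  exists AA, [/\ uniq (flatten AA), forall A, A \in AA -> good A &
    forall Q, size Q = l -> V Q -> (h < count (Ab Q) AA)%N].
Proof.
move=> b2 bW qP hP; have d0 : 0 <= 1 - beta / 4 by have := beta_le1; lra.
have Phi_ge0 AA : 0 <= Phi AA.
  by apply: Ex_ge0 => Q; rewrite mulr_ge0 ?ler0n // exprn_ge0 // invr_ge0 ler0n.
have step j : (j <= q * h)%N -> exists AA,
    [/\ admissible AA, (size AA <= j)%N & Phi AA <= (1 - beta / 4) ^+ j].
  elim: j => [|j IH] jq.
    exists [::]; split=> //; rewrite expr0 -[leRHS](Ex_cst T0 l).
    by apply: ler_Ex => Q _; rewrite expr0 mulr1; case: (V Q); rewrite ?ler01.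
  have [AA [adm sAA PA]] := IH (ltnW jq).
  have sb : b%:R * ((b * size AA)%:R / #|T|%:R) <= beta / 4.
    apply: le_trans bW; rewrite ler_wpM2l ?ler0n // ler_wpM2r ?invr_ge0 ?ler0n //.
    by rewrite ler_nat leq_mul // (leq_trans sAA) // ltnW.
  have [AA' [adm' sAA' PA']] := absorbing_step adm b2 sb.
  exists AA'; split=> //; first exact: leq_trans sAA' _.
  by apply: le_trans PA' _; rewrite exprS; apply: ler_wpM2l.
have [AA [[uA HA] _ PA]] := step _ (leqnn _).
exists AA; split=> // [A /HA[]|Q sQ VQ] //.
rewrite ltnNge; apply/negP => cQ; move: hP; rewrite ltnNge => /negP; apply.
have half_ge0 : 0 <= 2^-1 :> R by rewrite invr_ge0 ler0n.
(* [Phi] is an average over [#|T| ^ l] words, so the term of [Q], at least 2^(-h), is at most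
   [#|T| ^ l] times [Phi AA]; and [q] steps gain a factor 4, so [q * h] steps gain 4^h. *)
have : 2^-1 ^+ h <= #|T|%:R ^+ l * 4^-1 ^+ h :> R.
  apply: le_trans (_ : #|T|%:R ^+ l * Phi AA <= _); last first.
    rewrite ler_wpM2l ?exprn_ge0 ?ler0n //; apply: le_trans PA _.
    by rewrite exprM ler_pow // exprn_ge0.
  apply: le_trans (point_le_Ex (f := fun Q => (V Q)%:R * 2^-1 ^+ count (Ab Q) AA) T0 _ sQ).
    by rewrite VQ mul1r ler_wiXn2l //; lra.
  by move=> u; rewrite mulr_ge0 ?ler0n // exprn_ge0.
have -> : 4^-1 = 2^-1 * 2^-1 :> R by lra.
rewrite exprMn mulrA ler_pMl ?exprn_gt0 ?invr_gt0 ?ltr0n //.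
by rewrite exprVn ler_pdivlMr ?exprn_gt0 ?ltr0n // mul1r -!natrX ler_nat.
Qed.

End AbsorbingFamily.

(** * Links, codegrees and the densities they force *)

Section Density.
Variables (R : realType) (k m n : nat) (T : finType) (part : T -> 'I_k).
Variables (E : {set {set T}}) (x0 : T).
Hypotheses (k_gt1 : (1 < k)%N) (m_gt0 : (0 < m)%N) (n_gt0 : (0 < n)%N).
Hypothesis E_kpartite : is_kpartite_kgraph part E.
Hypothesis part_size : parts_of_size part n.
Variables (eps alpha mu : R).
Hypotheses (eps_gt0 : 0 < eps) (alpha_gt0 : 0 < alpha) (mu_ge0 : 0 <= mu).
Hypothesis E_dense : pmu_dense part E (1 / 2 + eps) mu.
Hypothesis E_codegree : partite_mindeg_ge part E (k - 1) (alpha * n%:R).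

Local Notation pt := (pt part).
Local Notation trans := (trans part).
Local Notation edge := (edge part E).
Local Notation tile := (tile m part E x0).
Local Notation tiled := (tiled m part E x0).
Local Notation swap := (swap m part E x0).
Local Notation kappa := (k%:R^-1 : R).
Local Notation nbr_const := (nbr_const k alpha).
Local Notation swap_const := (swap_const k m eps alpha).
Local Notation swap_size := (swap_size k m).
Local Notation absorb_const := (absorb_const k m eps alpha).
Local Notation absorb_size := (absorb_size k m).
Local Notation upd v i x := (set_nth x0 v i x).

Lemma T_gt0 : (0 < #|T|)%N.
Proof. by apply/card_gt0P; exists x0. Qed.
#[local] Hint Resolve T_gt0 : core.

Let k_gt0 : (0 < k)%N := ltnW k_gt1.

Lemma card_T : #|T| = (k * n)%N.
Proof.
rewrite -sum1_card (partition_big part xpredT) //=.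
rewrite (eq_bigr (fun=> n)) ?sum_nat_const ?card_ord // => i _.
by rewrite sum1dep_card; apply/eqP; apply: (forallP part_size).
Qed.

Lemma avg_pt i : (i < k)%N -> avg (fun x => (pt x == i)%:R) = kappa.
Proof.
move=> ik; rewrite avg_pred card_T.
have -> : #|[pred x | pt x == i]| = n.
  by rewrite -(eqP (forallP part_size (Ordinal ik))) cardsE; apply: eq_card.
by rewrite natrM invfM mulrA mulrAC divff ?mul1r // pnatr_eq0 -lt0n.
Qed.

Lemma Ex_pattern c : all (fun i => (i < k)%N) c ->
  Ex (size c) (fun v => (map pt v == c)%:R) = kappa ^+ size c.
Proof.
elim: c => [|i c IH] /=; first by rewrite Ex0 //.
case/andP=> ik /IH {}IH; rewrite Ex_cons exprS -IH -(avg_pt ik) -avgMr.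
apply: eq_avg => x; rewrite -ExMl; apply: eq_Ex => s _ /=.
by rewrite eqseq_cons -natrM mulnb.
Qed.

Lemma Ex_trans : Ex k (fun v => (trans v)%:R) = kappa ^+ k.
Proof.
have := @Ex_pattern (iota 0 k); rewrite size_iota; apply.
by apply/allP => i; rewrite mem_iota.
Qed.

Lemma map_upd v i x : (i < size v)%N ->
  map pt (upd v i x) = set_nth (pt x0) (map pt v) i (pt x).
Proof.
by move=> iv; rewrite !set_nthE size_map iv map_cat /= map_take map_drop.
Qed.

(* v is transversal up to its i-th entry, which is ignored. *)
Definition off i v := set_nth (pt x0) (map pt v) i i == iota 0 k.

Lemma trans_upd v i x : size v = k -> (i < k)%N ->
  trans (upd v i x) = (pt x == i) && off i v.
Proof.
move=> vk ik; rewrite /trans map_upd ?vk // /off.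
case: (pt x =P i) => [->//|xi]; apply/eqP => /(congr1 (nth (pt x0) ^~ i)).
by rewrite nth_set_nth /= eqxx nth_iota.
Qed.

Lemma Ex_off i : (i < k)%N -> Ex k (fun v => (off i v)%:R) = kappa ^+ k.-1.
Proof.
move=> ik; have k0 : kappa != 0 by rewrite invr_eq0 pnatr_eq0; lia.
apply: (mulfI k0); rewrite -exprS prednK; last by lia.
rewrite -Ex_trans [RHS](Ex_set_nth T_gt0 x0 _ ik) -(avg_pt ik) -avgMr.
apply: eq_avg => x; rewrite -ExMl; apply: eq_Ex => v vk.
by rewrite trans_upd // -natrM mulnb.
Qed.

Lemma edge_trans v : edge v -> trans v.
Proof. by case/andP. Qed.

Lemma edge_upd v i x : size v = k -> (i < k)%N -> edge (upd v i x) ->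
  pt x = i /\ off i v.
Proof. by move=> vk ik /edge_trans; rewrite trans_upd // => /andP[/eqP]. Qed.

(** Removing from [v] its vertex in the part [i] leaves a legal set of size [k - 1]. At least
    [alpha * n] of the [k * n] vertices complete it to an edge, and each of them fits at position
    [i]. *)
Lemma codegree v i : trans v -> (i < k)%N ->
  alpha * kappa <= avg (fun x => (edge (upd v i x))%:R).
Proof.
move=> tv ik; have vk := trans_size tv; have /eqP ev := tv.
have uv : uniq (map pt v) by rewrite ev iota_uniq.
have ptn a : (a < k)%N -> pt (nth x0 v a) = a.
  by move=> ak; rewrite -(nth_map x0 0%N pt) ?vk // ev nth_iota.
have vP x : x \in v -> exists2 a, (a < k)%N & x = nth x0 v a.
  by move/(nthP x0) => [a]; rewrite vk => ak <-; exists a.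
have inj : {in v &, injective pt}.
  by move=> _ _ /vP[a ak ->] /vP[b bk ->]; rewrite !ptn // => ->.
pose S := [set x in v | pt x != i].
have SE : S = [set x in v] :\ nth x0 v i.
  apply/setP => x; rewrite !inE andbC; case xv : (x \in v); rewrite ?andbF //= !andbT.
  congr negb; apply/eqP/eqP => [xi|->]; last exact: ptn.
  by apply: inj; rewrite ?mem_nth ?vk // xi ptn.
have Sk : #|S| = (k - 1)%N.
  have := cardsD1 (nth x0 v i) [set x in v]; rewrite -SE inE mem_nth ?vk //.
  by rewrite cardsE (card_uniqP (map_uniq uv)) vk => ->; rewrite add1n subSS subn0.
have legS : legal part S.
  apply/forallP => j; apply/card_le1_eqP => x y.
  rewrite !inE => /andP[/andP[xv _] /eqP xj] /andP[/andP[yv _] /eqP yj].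
  by apply: inj => //; rewrite /pt xj yj.
have := E_codegree legS Sk; rewrite avg_pred card_T => dS.
have {dS} : alpha * n%:R <= #|[pred x | edge (upd v i x)]|%:R.
  apply: le_trans dS _; rewrite ler_nat /deg.
  (* The sets counted by [deg] have one element, so they are compared with the singletons of the
     completing vertices. *)
  rewrite -[leqRHS](card_imset _ (@set1_inj T)); apply: subset_leq_card.
  apply/subsetP => S'; rewrite inE Sk (subKn (ltnW k_gt1)).
  case/andP=> /cards1P[x ->] SxE; apply: imset_f; rewrite inE.
  have := forallP E_kpartite (S :|: [set x]).
  rewrite SxE /= => /andP[/eqP Sxk /forallP leg].
  have xS : x \notin S.
    apply/negP => xS; move: Sxk; rewrite (setUidPl _) ?sub1set // Sk => /eqP.
    by rewrite -{2}(prednK (ltnW k_gt1)) subn1 ltn_eqF.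
  (* In any other part, [x] would meet a vertex [w] of [S]; legality of the edge would give [x = w],
     against [xS]. *)
  have xi : pt x = i.
    apply/eqP; apply: contraNT xS => xi.
    have jk : (pt x < k)%N by apply: ltn_ord.
    pose w := nth x0 v (pt x).
    have wS : w \in S by rewrite inE mem_nth ?vk // ptn.
    have /card_le1_eqP/(_ w x) := leg (part x).
    have wx : part w == part x by apply/eqP/val_inj; exact: ptn.
    have xU : x \in S :|: [set x] by rewrite in_setU in_set1 eqxx orbT.
    have wU : w \in S :|: [set x] by rewrite in_setU wS.
    by rewrite [w \in _]in_set wU wx [x \in [set _ in _ | _]]in_set xU eqxx => ->.
  have tu : trans (upd v i x).
    rewrite trans_upd // xi eqxx /off ev; apply/eqP/(@eq_from_nth _ (pt x0)).
      by rewrite size_set_nth size_iota; apply/maxn_idPr.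
    move=> a _; rewrite nth_set_nth /=; case: eqP => // ->.
    by rewrite nth_iota.
  apply/andP; split=> //; suff -> : [set z in upd v i x] = S :|: [set x] by [].
  apply/eqP; rewrite eqEcard; apply/andP; split.
    apply/subsetP => z; rewrite in_set => /(nthP x0)[a].
    rewrite (trans_size tu) => ak <-; rewrite nth_set_nth /= in_setU in_set1.
    case: eqP => [_|/eqP ai]; first by rewrite eqxx orbT.
    by rewrite in_set mem_nth ?vk // ptn // ai.
  rewrite Sxk cardsE (card_uniqP _) ?(trans_size tu) //.
  by apply: (@map_uniq _ _ pt); rewrite (eqP tu) iota_uniq.
move=> H; rewrite natrM invfM -[alpha](mulfK (_ : n%:R != 0)) ?pnatr_eq0 -?lt0n //.
rewrite [k%:R^-1 / _]mulrC mulrA.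
by rewrite ler_wpM2r ?invr_ge0 ?ler0n // ler_wpM2r ?invr_ge0 ?ler0n.
Qed.

(** The overwritten letter is kept as a dummy, so that links of all vertices are averages over the
    same words of length [k]. A full link has value kappa^(k-1), not 1. *)
Definition link i x : R := Ex k (fun v => (edge (upd v i x))%:R).
Definition link2 i x y : R :=
  Ex k (fun v => (edge (upd v i x) && edge (upd v i y))%:R).

Lemma link2C i x y : link2 i x y = link2 i y x.
Proof. by apply: eq_Ex => v _; rewrite andbC. Qed.

Lemma link2_ge0 i x y : 0 <= link2 i x y.
Proof. by apply: Ex_ge0 => v; rewrite ler0n. Qed.

Lemma link2_le1 i x y : link2 i x y <= 1.
Proof.
rewrite -[leRHS](Ex_cst T_gt0 k); apply: ler_Ex => v _.
by rewrite (ler_nat _ _ 1) leq_b1.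
Qed.

Lemma ak_ge0 : 0 <= alpha * kappa.
Proof. by rewrite mulr_ge0 ?invr_ge0 ?ler0n // ltW. Qed.

(** Words that become transversal with [x] at position [i] have proportion kappa^(k-1); resampling
    another position [j] makes each of them an edge with probability at least [alpha * kappa]. *)
Lemma link_ge i x : (i < k)%N -> pt x = i -> alpha * kappa ^+ k <= link i x.
Proof.
move=> ik xi.
have [j jk ji] : exists2 j, (j < k)%N & j != i.
  by case: (i =P 0%N) => [->|/eqP i0]; [exists 1%N | exists 0%N; rewrite 1?eq_sym].
rewrite /link (Ex_set_nth T_gt0 x0 _ jk) -Ex_avg.
apply: le_trans (_ : Ex k (fun v => (trans (upd v i x))%:R * (alpha * kappa)) <= _).
  rewrite ExMr (eq_Ex (g := fun v => (off i v)%:R)); last first.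
    by move=> v vk; rewrite trans_upd // xi eqxx.
  by rewrite Ex_off // mulrCA -exprSr prednK.
apply: ler_Ex => v vk.
case tv : (trans _); last by rewrite mul0r avg_ge0 // => a; rewrite ler0n.
rewrite mul1r; apply: le_trans (codegree tv jk) _; apply: ler_avg => z.
by rewrite [upd (upd v j z) i x]set_set_nth (negPf ji).
Qed.

Lemma avg_link2_ge i x : (i < k)%N ->
  link i x * (alpha * kappa) <= avg (link2 i x).
Proof.
move=> ik; rewrite /link2 -Ex_avg /link -ExMr; apply: ler_Ex => v vk.
case ex : (edge _); last by rewrite mul0r avg_ge0 // => a; rewrite ler0n.
rewrite mul1r; apply: le_trans (codegree (edge_trans ex) ik) _.
by apply: ler_avg => y; rewrite set_set_nth eqxx.
Qed.

(** Inclusion-exclusion: both links live inside the words satisfying [off i], of proportion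
    kappa^(k-1). *)
Lemma link2_ge i x y : (i < k)%N ->
  link i x + link i y - kappa ^+ k.-1 <= link2 i x y.
Proof.
move=> ik; rewrite lerBlDr -(Ex_off ik) /link /link2 -!ExD; apply: ler_Ex => v vk.
case ex : (edge (upd v i x)); case ey : (edge (upd v i y)); rewrite /= ?addr0 ?add0r ?ler0n //.
- by have [_ ->] := edge_upd vk ik ex.
- by have [_ ->] := edge_upd vk ik ex.
- by have [_ ->] := edge_upd vk ik ey.
Qed.

Lemma dense_Ex (X : 'I_k -> {set T}) (P : pred (seq T)) :
  (forall i, X i \subset [set x | part x == i]) ->
  (forall v, edge v -> (forall i : 'I_k, nth x0 v i \in X i) -> P v) ->
  (1 / 2 + eps) * \prod_(i < k) (#|X i|%:R / #|T|%:R) - mu <=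
  Ex k (fun v => (P v)%:R).
Proof.
move=> XV XP; have N0 : 0 < #|T|%:R ^+ k :> R by rewrite exprn_gt0 // ltr0n T_gt0.
rewrite -(ler_pM2l N0) Ex_sum_tuple ?T_gt0 //.
have := E_dense XV; rewrite mulrBr [_ * mu]mulrC big_split /= prodr_const.
rewrite card_ord exprVn [#|T|%:R ^+ k * _]mulrCA [#|T|%:R ^+ k * _]mulrCA.
rewrite divff ?gt_eqF // mulr1 => H; apply: le_trans H _; rewrite ler_nat /e_H.
pose g (f : {ffun 'I_k -> T}) := [tuple f i | i < k].
have g_inj : injective g.
  by move=> f f' ff; apply/ffunP => i; rewrite -[LHS](tnth_mktuple f) -/(g f) ff tnth_mktuple.
rewrite -(card_imset _ g_inj); apply/subset_leq_card/subsetP => _ /imsetP[f + ->].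
rewrite !inE => /andP[/forallP fX fE].
have gE : g f = [seq f i | i <- enum 'I_k] :> seq T by [].
apply: XP => [|i]; last first.
  by rewrite gE (nth_map i) ?size_enum_ord // nth_ord_enum.
apply/andP; split.
  rewrite /trans gE -map_comp -val_enum_ord; apply/eqP/eq_map => i /=.
  by have := subsetP (XV i) _ (fX i); rewrite inE => /eqP; rewrite /pt => ->.
congr (_ \in E): fE; apply/setP => x; rewrite inE gE.
apply/imsetP/mapP => [[i _ ->]|[i _ ->]]; exists i => //.
by rewrite mem_enum.
Qed.

Lemma card_class (i : 'I_k) : #|[set x | part x == i]|%:R / #|T|%:R = kappa.
Proof. by rewrite -(avg_pt (ltn_ord i)) avg_pred cardsE. Qed.

Lemma link_dense (i : 'I_k) (X : {set T}) : X \subset [set x | part x == i] ->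
  (1 / 2 + eps) * (#|X|%:R / #|T|%:R * kappa ^+ k.-1) - mu <=
  avg (fun x => (x \in X)%:R * link i x).
Proof.
move=> Xi; pose Xs j := if j == i then X else [set x | part x == j].
have -> : avg (fun x => (x \in X)%:R * link i x) =
    Ex k (fun v => ((nth x0 v i \in X) && edge v)%:R).
  rewrite [RHS](Ex_set_nth T_gt0 x0 _ (ltn_ord i)); apply: eq_avg => x.
  rewrite -ExMl; apply: eq_Ex => v _.
  by rewrite nth_set_nth /= eqxx -natrM mulnb.
apply: le_trans (dense_Ex (X := Xs) _ _) => [|j|v ev H].
- rewrite (bigD1 i) //= {1}/Xs eqxx (eq_bigr (fun=> kappa)).
    by rewrite prodr_const cardC1 card_ord.
  by move=> j ji; rewrite /Xs (negPf ji) card_class.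
- by rewrite /Xs; case: eqP => [->|].
- by rewrite ev andbT; have := H i; rewrite /Xs eqxx.
Qed.

(** Sum the inclusion-exclusion bound over [X] and [X']. By [link_dense] each link sum contributes
    (1/2 + eps) times the full value, and subtracting that value once leaves the surplus
    [2 * eps]. *)
Lemma link2_dense (i : 'I_k) (X X' : {set T})
  (xi : R := #|X|%:R / #|T|%:R) (xi' : R := #|X'|%:R / #|T|%:R) :
  X \subset [set x | part x == i] -> X' \subset [set x | part x == i] ->
  2 * eps * xi * xi' * kappa ^+ k.-1 - mu * (xi + xi') <=
  avg (fun x => avg (fun y => (x \in X)%:R * (y \in X')%:R * link2 i x y)).
Proof.
move=> XV XV'; set th := kappa ^+ _.
have avX : avg (fun x => (x \in X)%:R) = xi by rewrite avg_pred.
have avX' : avg (fun x => (x \in X')%:R) = xi' by rewrite avg_pred.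
have xi0 : 0 <= xi by rewrite mulr_ge0 ?invr_ge0 ?ler0n.
have xi'0 : 0 <= xi' by rewrite mulr_ge0 ?invr_ge0 ?ler0n.
have := link_dense XV; have := link_dense XV'; rewrite -/xi -/xi' -/th.
set A' := avg _; set A := avg _ => HA' HA.
apply: le_trans (_ : xi' * (A - th * xi) + xi * A' <= _).
  have := ler_wpM2l xi0 HA'; have := ler_wpM2l xi'0 HA; lra.
apply: le_trans (_ : avg (fun x => avg (fun y =>
   (y \in X')%:R * ((x \in X)%:R * (link i x - th)) +
   (x \in X)%:R * ((y \in X')%:R * link i y))) <= _); last first.
  apply: ler_avg => x; apply: ler_avg => y.
  have := link2_ge x y (ltn_ord i); rewrite -/th.
  by case: (x \in X); case: (y \in X'); rewrite /= ?mul0r ?mul1r; lra.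
under eq_avg do rewrite avgD avgMr avgMl avX' -/A'.
rewrite avgD avgMl avgMr avX lerD2r ler_wpM2l //.
rewrite le_eqVlt; apply/orP; left; apply/eqP.
under eq_avg do rewrite mulrDr.
by rewrite avgD avgMr avX mulrN [th * _]mulrC.
Qed.

(** The new vertex stands first in block [i]. Choices with [phi i = 0] see it and use the updated
    edge; all others give an edge of the old word. *)
Lemma tile_set_nth G s i x : size s = (k * m)%N -> blowup m k G s -> (i < k)%N ->
  (forall v, G v -> edge v && edge (upd v i x)) -> tile (upd s (i * m)%N x).
Proof.
move=> sz bl ik GE; split.
  by rewrite size_set_nth sz; apply/maxn_idPr; rewrite ltn_pmul2r.
move=> phi phim; have /GE/andP[e1 e2] := blowup_choice x0 sz bl phim.
have jE j : (j < k)%N -> (j * m + phi j == i * m)%N = (j == i) && (phi i == 0)%N.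
  move=> jk; apply/eqP/andP => [H|[/eqP-> /eqP->]]; last by rewrite addn0.
  have ji : j = i.
    have := congr1 (divn^~ m) H.
    by rewrite /= divnMDl // divn_small ?phim // addn0 mulnK.
  by rewrite ji eqxx; split=> //; apply/eqP; move: H; rewrite ji; lia.
case p0 : (phi i == 0)%N.
- rewrite (_ : mkseq _ k = upd (mkseq (fun i => nth x0 s (i * m + phi i)) k) i x) //.
  apply: (@eq_from_nth _ x0) => [|j].
    by rewrite size_set_nth !size_mkseq; apply/esym/maxn_idPr.
  rewrite size_mkseq => jk; rewrite nth_mkseq // !nth_set_nth /= jE // p0 andbT.
  by case: eqP => // _; rewrite nth_mkseq.
- rewrite (_ : mkseq _ k = mkseq (fun i => nth x0 s (i * m + phi i)) k) //.
  apply: (@eq_from_nth _ x0) => [|j]; rewrite ?size_mkseq // => jk.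
  by rewrite !nth_mkseq // nth_set_nth /= jE // p0 andbF.
Qed.

(* Drop from a blow-up of the edges through both links one vertex of V_i: either x
   or y can take its place. *)
Lemma swap_density1 i x y : (i < k)%N ->
  (link2 i x y * (alpha * kappa)) ^+ (m ^ k) <=
  Ex (k * m).-1 (fun s => `[< swap x y s >]%:R).
Proof.
move=> ik; pose G v := [&& edge v, edge (upd v i x) & edge (upd v i y)].
have HG : link2 i x y * (alpha * kappa) <= Ex k (fun v => (G v)%:R).
  rewrite (Ex_set_nth T_gt0 x0 _ ik) -Ex_avg /link2 -ExMr; apply: ler_Ex => v vk.
  case exy : (_ && _); last by rewrite mul0r avg_ge0 // => z; rewrite ler0n.
  have /andP[ex ey] := exy.
  rewrite mul1r; apply: le_trans (codegree (edge_trans ex) ik) _.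
  apply: ler_avg => z; rewrite /G.
  have updK w u : upd (upd v i w) i u = upd v i u by rewrite set_set_nth eqxx.
  by rewrite !updK ex ey !andbT.
have km0 : (0 < k * m)%N by rewrite muln_gt0 m_gt0 andbT; lia.
apply: le_trans (_ : Ex k (fun v => (G v)%:R) ^+ (m ^ k) <= _).
  by apply: ler_pow => //; rewrite mulr_ge0 ?link2_ge0 ?ak_ge0.
apply: le_trans (blowup_avg _ T_gt0 m k G) _.
have pk : (i * m < (k * m).-1.+1)%N by rewrite prednK // ltn_pmul2r.
(* Position [i * m] is the first of block [i]; a swap word is a blown-up word with that letter
   deleted. *)
rewrite -(Ex_drop1 T_gt0 _ pk) prednK //; apply: ler_Ex => s sz.
case bl : (blowup _ _ _ _); last by rewrite ler0n.
rewrite ler_nat lt0b; apply/asboolP.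
have imk : (i * m < size s)%N by rewrite sz ltn_pmul2r.
have tl z : (z = x) \/ (z = y) -> tiled (z :: (take (i * m) s ++ drop (i * m).+1 s)).
  move=> Hz; have : tile (upd s (i * m)%N z).
    apply: tile_set_nth bl ik _ => // v /and3P[ev ex ey].
    by case: Hz => ->; rewrite ev.
  move/tile_tiled; apply: tiled_perm.
  by rewrite set_nthE imk perm_catC /= perm_cons perm_catC.
by split; apply: tl; [left|right].
Qed.

(* Every x has a dense set of neighbours in the graph on V_i whose edges are the
   pairs with many common link edges, and by density more than 1/2 any two dense
   subsets of V_i are joined by many edges of this graph. So x and y are joined by
   many paths x - x' - y' - y. *)
Lemma swap_density (i : 'I_k) x y : part x = i -> part y = i ->
  2 * mu <= eps * kappa ^+ k.-1 * (nbr_const / 2) ^+ 2 ->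
  swap_const <= Ex swap_size (fun s => `[< swap x y s >]%:R).
Proof.
move=> xi yi mu_small; set c := (k * m).-1; set M := (m ^ k)%N.
have M0 : (0 < M)%N by rewrite expn_gt0 m_gt0.
have ik := ltn_ord i.
pose c1 := nbr_const; have c1_gt0 : 0 < c1 := (nbr_const_gt0 k_gt0 alpha_gt0).
have k0 := kappa_gt0 R k_gt0.
have th0 : 0 < kappa ^+ k.-1 by rewrite exprn_gt0.
have ak0 := ak_ge0.
pose N z := [set w | c1 / 2 <= link2 i z w].
have NV z : N z \subset [set w | part w == i].
  apply/subsetP => w; rewrite !inE; apply: contraTT => wi.
  suff -> : link2 i z w = 0 by rewrite -ltNge; lra.
  rewrite /link2 (eq_Ex (g := fun=> 0)) ?Ex_cst // => v vk.
  case ew : (edge (upd v i w)); rewrite ?andbF //.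
  have [wi' _] := edge_upd vk ik ew; case/eqP: wi; exact: val_inj.
(* The average of [link2 i z] is at least [c1]; it is at most 1 on [N z] and below [c1 / 2]
   elsewhere. *)
have Nbig z : part z = i -> c1 / 2 <= #|N z|%:R / #|T|%:R.
  move=> zi; have zi' : pt z = i by rewrite /pt zi.
  have H1 : c1 <= avg (link2 i z).
    apply: le_trans (avg_link2_ge z ik); rewrite /c1 /nbr_const ler_wpM2r //.
    exact: link_ge.
  have H2 : avg (link2 i z) <= avg (fun w => (w \in N z)%:R + c1 / 2).
    apply: ler_avg => w; rewrite inE; have := link2_le1 i z w.
    by case: (lerP (c1 / 2)) => /= *; lra.
  move: (le_trans H1 H2); rewrite avgD avg_cst // avg_pred.
  have -> : #|[eta mem (N z)]| = #|N z| by [].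
  lra.
have := link2_dense (NV x) (NV y); have := Nbig x xi; have := Nbig y yi.
set xi1 := #|N x|%:R / _; set xi2 := #|N y|%:R / _; move=> b2 b1 D.
have Xle1 z : #|N z|%:R / #|T|%:R <= 1 :> R.
  by rewrite ler_pdivrMr ?ltr0n // mul1r ler_nat max_card.
(* The bound on [mu] lets the error consume at most half of the main term, whose factor is
   [2 * eps]. *)
have {}D : eps * kappa ^+ k.-1 * (c1 / 2) ^+ 2 <=
   avg (fun x' => avg (fun y' => (x' \in N x)%:R * (y' \in N y)%:R * link2 i x' y')).
  apply: le_trans D.
  have e1 : mu * (xi1 + xi2) <= 2 * mu.
    by rewrite mulrC ler_wpM2r //; have := Xle1 x; have := Xle1 y; rewrite -/xi1 -/xi2; lra.
  have e2 : (c1 / 2) ^+ 2 <= xi1 * xi2 by rewrite expr2 ler_pM //; lra.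
  have et : 0 <= eps * kappa ^+ k.-1 by rewrite mulr_ge0 // ltW.
  have := ler_wpM2l et e2; rewrite -/c1 in mu_small *; nra.
rewrite /swap_size -/c Ex_cat // Ex_cons.
under [leRHS]eq_avg do rewrite Ex1 //.
pose h u w := (link2 i u w * (alpha * kappa)) ^+ M.
have h0 u w : 0 <= h u w by rewrite exprn_ge0 // mulr_ge0 ?link2_ge0.
pose a := (c1 / 2 * (alpha * kappa)) ^+ M.
have a0 : 0 <= a by rewrite exprn_ge0 // mulr_ge0 //; lra.
have ha u w : c1 / 2 <= link2 i u w -> a <= h u w.
  move=> H; apply: ler_pow; first by rewrite mulr_ge0 //; lra.
  by rewrite ler_wpM2r.
apply: le_trans (_ : avg (fun x' => avg (fun y' => h x x' * (h x' y' * h y' y))) <= _); last first.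
  apply: ler_avg => x'; apply: ler_avg => y'.
  rewrite Ex_cat //.
  apply: le_trans (_ : Ex c (fun s1 => `[< swap x x' s1 >]%:R *
      Ex c (fun s2 => `[< swap x' y' s2 >]%:R * Ex c (fun s3 => `[< swap y' y s3 >]%:R))) <= _).
    by rewrite !ExMr; do ?apply: ler_pM; rewrite ?mulr_ge0 //; apply: swap_density1.
  apply: ler_Ex => s1 _; rewrite Ex_cat // -ExMl; apply: ler_Ex => s2 _.
  rewrite mulrA -ExMl; apply: ler_Ex => s3 _.
  rewrite -!natrM ler_nat !mulnb.
  case: asboolP => //= p1; case: asboolP => //= p2; case: asboolP => //= p3.
  rewrite lt0b; apply/asboolP; exact: (swap_chain p1 p2 p3).
(* For x' in [N x] and y' in [N y] both outer factors are at least [a]; for other pairs the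
   indicators make the smaller side vanish, as [M] is positive. *)
apply: le_trans (_ : a ^+ 2 * avg (fun x' => avg (fun y' =>
   ((x' \in N x)%:R * (y' \in N y)%:R * link2 i x' y' * (alpha * kappa)) ^+ M)) <= _); last first.
  rewrite -avgMl; apply: ler_avg => x'; rewrite -avgMl; apply: ler_avg => y'.
  case Nx : (x' \in N x); last by rewrite !mul0r expr0n (gtn_eqF M0) mulr0 !mulr_ge0.
  case Ny : (y' \in N y); last by rewrite mulr0 !mul0r expr0n (gtn_eqF M0) mulr0 !mulr_ge0.
  rewrite !mul1r -/(h x' y') expr2.
  have g1 : a <= h x x' by apply: ha; move: Nx; rewrite inE.
  have g2 : a <= h y' y by apply: ha; move: Ny; rewrite inE link2C.
  rewrite [h x' y' * _]mulrC mulrA ler_wpM2r // ler_pM //.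
rewrite /swap_const -/c1 -/M -/a ler_wpM2l ?sqr_ge0 //.
pose g x' y' := (x' \in N x)%:R * (y' \in N y)%:R * link2 i x' y' * (alpha * kappa).
have g0 x' y' : 0 <= g x' y'.
  exact: mulr_ge0 (mulr_ge0 (mulr_ge0 (ler0n _ _) (ler0n _ _)) (link2_ge0 _ _ _)) ak0.
apply: le_trans (_ : avg (fun x' => avg (g x')) ^+ M <= _).
  apply: ler_pow.
    by apply: mulr_ge0 ak0; rewrite mulr_ge0 ?sqr_ge0 // mulr_ge0 // ltW.
  rewrite /g; under [leRHS]eq_avg do rewrite avgMr.
  by rewrite avgMr ler_wpM2r.
apply: le_trans (avg_pow _ _ _) _ => // [x'|]; first exact: avg_ge0.
by apply: ler_avg => x'; apply: avg_pow.
Qed.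

Lemma tile_density : mu <= eps * kappa ^+ k ->
  (kappa ^+ k / 2) ^+ (m ^ k) <= Ex (k * m) (fun t => `[< tile t >]%:R).
Proof.
move=> mu_small; have k0 : 0 < kappa ^+ k by rewrite exprn_gt0 // (kappa_gt0 R k_gt0).
apply: le_trans (_ : Ex k (fun v => (edge v)%:R) ^+ (m ^ k) <= _).
  apply: ler_pow; first by lra.
  apply: le_trans (dense_Ex (X := fun i => [set x | part x == i]) _ _) => //.
  rewrite (eq_bigr (fun=> kappa)); last by move=> i _; rewrite card_class.
  rewrite prodr_const card_ord; lra.
apply: le_trans (blowup_avg _ T_gt0 m k edge) _; apply: ler_Ex => t st.
case bl : (blowup _ _ _ _); last by rewrite ler0n.
rewrite ler_nat lt0b; apply/asboolP; split=> // phi.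
exact: blowup_choice.
Qed.

Lemma swaps_density c (d : R) ps : 0 <= d ->
  (forall p, p \in ps -> d <= Ex c (fun s => `[< swap p.1 p.2 s >]%:R)) ->
  d ^+ size ps <= Ex (size ps * c) (fun s => `[< swaps m part E x0 c ps s >]%:R).
Proof.
move=> d0; elim: ps => [|p ps IH] H /=.
  by rewrite mul0n Ex0 // expr0 ler1n lt0b; apply/asboolP.
rewrite exprS mulSn Ex_cat //.
apply: le_trans (_ : Ex c (fun s => `[< swap p.1 p.2 s >]%:R *
   Ex (size ps * c) (fun s => `[< swaps m part E x0 c ps s >]%:R)) <= _).
  rewrite ExMr ler_pM ?exprn_ge0 //; first by apply: H; rewrite inE eqxx.
  by apply: IH => q qps; apply: H; rewrite inE qps orbT.
apply: ler_Ex => s sc; rewrite -ExMl; apply: ler_Ex => u _.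
rewrite -natrM mulnb ler_nat; case: asboolP => //= p1; case: asboolP => //= p2.
by rewrite lt0b; apply/asboolP; rewrite take_size_cat // drop_size_cat.
Qed.

(** A tile and [Q] have the same pattern, so letters at equal positions share a part and
    [swap_density] applies to each of the [k * m] pairs, with separate pieces of the word. *)
Lemma absorb_density Q : map pt Q = pat k m ->
  mu <= eps * kappa ^+ k ->
  2 * mu <= eps * kappa ^+ k.-1 * (nbr_const / 2) ^+ 2 ->
  absorb_const <= Ex absorb_size (fun A => `[< absorbs m part E x0 Q A >]%:R).
Proof.
move=> QP mu1 mu2; have d0 := ltW (swap_const_gt0 m k_gt0 eps_gt0 alpha_gt0).
rewrite /absorb_size Ex_cat //.
apply: le_trans (_ : Ex (k * m) (fun t => `[< tile t >]%:R * swap_const ^+ (k * m)) <= _).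
  by rewrite ExMr ler_wpM2r ?exprn_ge0 // tile_density.
apply: ler_Ex => t st; case: asboolP => [tt|_]; last first.
  by rewrite mul0r Ex_ge0 // => s; rewrite ler0n.
have QT : size Q = size t by rewrite -(size_map pt Q) QP -(tile_pat m_gt0 tt) size_map.
have sz : size (zip t Q) = (k * m)%N by rewrite size_zip QT minnn.
rewrite mul1r -{1 2}sz; apply: le_trans (swaps_density (c := swap_size) (ps := zip t Q) d0 _) _.
  move=> [x y] xy /=; apply: (swap_density (i := part x)) => //.
  have : (x, y) \in zip t Q by [].
  case/(nthP (x0, x0)) => a; rewrite size_zip QT minnn => at_.
  rewrite nth_zip ?QT // => -[<- <-]; apply: val_inj.
  change (pt (nth x0 Q a) = pt (nth x0 t a)).
  by rewrite -!(nth_map x0 0%N pt) ?QT // QP (tile_pat m_gt0 tt).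
apply: ler_Ex => s _; rewrite ler_nat; case: asboolP => //= sw.
rewrite lt0b; apply/asboolP; exact: swaps_absorbs sw.
Qed.

Lemma count_class i (s : seq T) : uniq s ->
  #|[set x in s | part x == i]| = count (fun x => pt x == i) s.
Proof.
move=> us; rewrite -size_filter -(card_uniqP (filter_uniq _ us)) cardsE.
by apply: eq_card => x; rewrite mem_filter andbC.
Qed.

(** * Tiling all but a small balanced remainder, and absorbing it *)

Section Covering.
Variable D : nat.
Hypothesis D_gt0 : (0 < D)%N.
Let rho : R := (kappa / D%:R) ^+ k.
Hypothesis mu_small : mu <= rho / 4.
Hypothesis n_large : (k * m)%:R ^+ 2 / n%:R < (rho / 4) ^+ (m ^ k).

(** Each class of [s] has density at least kappa/D, so edges inside [s] have density at least
    [rho / 4]. Their blow-ups then outnumber the words with a repeated letter. *)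
Lemma tile_in (s : seq T) : uniq s ->
  (forall i, (i < k)%N -> (n <= D * count (fun x => pt x == i) s)%N) ->
  exists t, [/\ tile t, uniq t & {subset t <= s}].
Proof.
move=> us cs; pose G v := edge v && all (mem s) v.
have rho0 : 0 < rho by rewrite exprn_gt0 // divr_gt0 ?(kappa_gt0 R k_gt0) ?ltr0n.
have GE : rho / 4 <= Ex k (fun v => (G v)%:R).
  pose X i := [set x in s | part x == i].
  apply: le_trans (dense_Ex (X := X) _ _); last 2 first.
  - by move=> i; apply/subsetP => x; rewrite !inE => /andP[].
  - move=> v ev vX; rewrite /G ev; apply/(all_nthP x0) => j.
    rewrite (trans_size (edge_trans ev)) => jk.
    by have := vX (Ordinal jk); rewrite inE => /andP[].
  have : rho <= \prod_(i < k) (#|X i|%:R / #|T|%:R).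
    rewrite /rho -[X in _ ^+ X](card_ord k) -prodr_const; apply: ler_prod => i _.
    rewrite ltW ?divr_gt0 ?(kappa_gt0 R k_gt0) ?ltr0n //= count_class // card_T natrM invfM.
    rewrite [_ / D%:R]mulrC [leRHS]mulrCA [leRHS]mulrC ler_wpM2r ?(ltW (kappa_gt0 R k_gt0)) //.
    rewrite ler_pdivlMr ?ltr0n // ler_pdivrMl ?ltr0n // -natrM ler_nat.
    exact: cs.
  set P := \prod_(_ < _) _ => rP.
  have e0 := eps_gt0; have ms := mu_small; nra.
have : (rho / 4) ^+ (m ^ k) <= Ex (k * m) (fun t => (blowup m k G t)%:R).
  apply: le_trans (blowup_avg _ T_gt0 m k G); apply: ler_pow => //.
  by rewrite divr_ge0 // ltW.
have [/existsP[t /andP[bl ut]] _|/existsPn H] :=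
    boolP [exists t : (k * m).-tuple T, blowup m k G t && uniq t].
  have st : size t = (k * m)%N by rewrite size_tuple.
  exists t; split=> //.
    split=> // phi phim; have := blowup_choice x0 st bl phim.
    by case/andP.
  move=> x /(nthP x0)[p]; rewrite st => pk <-.
  have : forall i, (i < k)%N -> (p %% m < m)%N by move=> i _; rewrite ltn_mod.
  (* A constant choice suffices to meet the letter at position [p], which must then lie in [s]. *)
  move/(blowup_choice (phi := fun=> (p %% m)%N) x0 st bl).
  case/andP=> _ /(all_nthP x0)/(_ (p %/ m)%N).
  rewrite size_mkseq ltn_divLR // => /(_ pk).
  by rewrite nth_mkseq ?ltn_divLR // -divn_eq.
move=> le1; exfalso.
have le2 : Ex (k * m) (fun t => (blowup m k G t)%:R) <=
    Ex (k * m) (fun t : seq T => (~~ uniq t)%:R) :> R.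
  apply: ler_avg => t; rewrite ler_nat; have := H t.
  by case: (blowup _ _ _ _); case: (uniq _).
have := le_trans (le_trans le1 le2) (Ex_nuniq_le R T_gt0 (k * m)).
apply/negP; rewrite -ltNge; apply: le_lt_trans n_large.
rewrite ler_wpM2l ?exprn_ge0 ?ler0n // lef_pV2 ?posrE ?ltr0n //.
by rewrite card_T ler_nat leq_pmull // ltnW.
Qed.

(** While [r] exceeds [h], every class has at least [h.+1] vertices, enough for [tile_in]; removing
    a tile keeps the classes balanced. *)
Lemma cover_up_to h r (s : seq T) : (n <= D * h.+1)%N -> uniq s ->
  (forall i, (i < k)%N -> count (fun x => pt x == i) s = (r * m)%N) ->
  exists s1 L r', [/\ tiled s1, perm_eq s (s1 ++ L), (r' <= h)%N &
    forall i, (i < k)%N -> count (fun x => pt x == i) L = (r' * m)%N].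
Proof.
move=> nD; elim: r s => [|r IH] s us cs.
  by exists [::], s, 0%N; split=> //; apply: tiled_nil.
have [rh|rh] := leqP r.+1 h.
  by exists [::], s, r.+1; split=> //; apply: tiled_nil.
have [|t [tt ut ts]] := tile_in us.
  move=> i ik; rewrite cs //; apply: leq_trans nD _; rewrite leq_mul //.
  by rewrite (leq_trans rh) // leq_pmulr.
have ps : perm_eq s (t ++ [seq x <- s | x \notin t]).
  rewrite -(perm_filterC (mem t) s) perm_cat2r uniq_perm ?filter_uniq // => x.
  by rewrite mem_filter andb_idr // => /ts.
have [||s1 [L [r' [t1 p1 r'h cL]]]] := IH [seq x <- s | x \notin t].
- exact: filter_uniq.
- move=> i ik; have := cs i ik; rewrite (permP ps) count_cat.
  by rewrite (count_pt_pat m_gt0 (tile_pat m_gt0 tt) ik) mulSn => /addnI.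
exists (t ++ s1), L, r'; split=> //; first exact: tiled_cat (tile_tiled tt) t1.
by rewrite (perm_trans ps) // -catA perm_cat2l.
Qed.

Lemma absorb_and_cover (beta : R) (q h : nat) :
  (m %| n)%N -> (n <= D * h.+1)%N ->
  beta <= absorb_const -> beta <= 1 ->
  mu <= eps * kappa ^+ k ->
  2 * mu <= eps * kappa ^+ k.-1 * (nbr_const / 2) ^+ 2 ->
  absorb_size%:R ^+ 2 / #|T|%:R <= beta / 4 ->
  absorb_size%:R * ((absorb_size * (q * h))%:R / #|T|%:R) <= beta / 4 ->
  (1 - beta / 4) ^+ q <= 4^-1 ->
  (#|T| ^ (k * m) < 2 ^ h)%N ->
  tiled (enum T).
Proof.
move=> mn nD b1 b2 mu1 mu2 H1 H2 H3 H4.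
pose V (Q : seq T) := map pt Q == pat k m.
pose good A := `[< tiled A >].
pose Ab Q A := `[< absorbs m part E x0 Q A >].
have [|Q VQ|AA [uAA gAA cAA]] := @absorbing_family R T absorb_size (k * m) V good Ab
    beta T_gt0 b2 _ _ q h H1 H2 H3 H4.
- by move=> Q A _ /asboolP[tA _]; apply/asboolP.
- by apply: le_trans b1 _; apply: absorb_density => //; apply/eqP.
have tAA A : A \in AA -> tiled A by move/gAA/asboolP.
pose W := flatten AA; have tW : tiled W := tiled_flatten tAA.
pose s := [seq x <- enum T | x \notin W].
have pW : perm_eq (enum T) (W ++ s).
  rewrite -(perm_filterC (mem W) (enum T)) perm_cat2r.
  apply: uniq_perm uAA _ => [|x]; first exact: filter_uniq (enum_uniq T).
  by rewrite mem_filter mem_enum andbT.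
have [c cW] := tiled_count m_gt0 tW.
have cT i : (i < k)%N -> count (fun x => pt x == i) (enum T) = n.
  move=> ik; rewrite -(eqP (forallP part_size (Ordinal ik))) -(count_class (Ordinal ik)) ?enum_uniq //.
  by apply: eq_card => x; rewrite !inE mem_enum.
(* The absorbers are tiled, hence balanced in multiples of [m]; as [m] divides [n], so is the
   rest. *)
have cs i : (i < k)%N -> count (fun x => pt x == i) s = ((n %/ m - c) * m)%N.
  move=> ik; have := cT i ik; rewrite (permP pW) count_cat cW // mulnBl divnK //.
  by move=> <-; rewrite addKn.
have [|s1 [L [r [t1 p1 rh cL]]]] := cover_up_to nD _ cs.
  exact: filter_uniq (enum_uniq T).
have [Qs [sQs HQs pL]] := split_balanced m_gt0 cL.
have tQ : tiled (W ++ flatten Qs).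
  apply: (absorb_all tAA) => Q QQs; rewrite sQs; apply: leq_trans rh (ltnW _).
  apply: cAA; last by rewrite /V HQs.
  by rewrite -(size_map pt) HQs // size_map size_iota.
apply: tiled_perm (tiled_cat t1 tQ); rewrite perm_sym (perm_trans pW) //.
rewrite perm_sym perm_catCA perm_cat2l perm_sym (perm_trans p1) // perm_cat2l.
exact: pL.
Qed.

End Covering.

End Density.

(** * Numerical estimates and the choice of constants *)

(** With u = h/(l+1) rounded down and u >= K, the left side is at most K (u+1)^l < (u+1)^(l+1) <=
    2^(u(l+1)) <= 2^h. *)
Lemma poly_lt_exp (C l : nat) :
  exists h0, forall h, (h0 <= h)%N -> ((C * h.+1) ^ l < 2 ^ h)%N.
Proof.
pose K := ((C * l.+1) ^ l)%N; exists (K * l.+1)%N => h hK.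
pose u := (h %/ l.+1)%N; have Ku : (K <= u)%N by rewrite leq_divRL.
have hu : (h.+1 <= l.+1 * u.+1)%N by rewrite mulnC ltn_ceil.
apply: leq_ltn_trans (_ : (K * u.+1 ^ l < _)%N).
  by rewrite -expnMn -mulnA; case: (l) hu => // l' hu; rewrite leq_exp2r // leq_mul.
apply: leq_trans (_ : (u.+1 ^ l.+1 <= _)%N).
  by rewrite expnS ltn_pmul2r ?expn_gt0.
apply: leq_trans (_ : ((2 ^ u) ^ l.+1 <= _)%N).
  by rewrite leq_exp2r // ltn_expl.
by rewrite -expnM leq_exp2l // leq_trunc_div.
Qed.

Lemma exists_nat_gt (R : archiRealFieldType) (x : R) : exists N : nat, x < N%:R.
Proof.
exists (Num.bound `|x|); apply: le_lt_trans (ler_norm x) _.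
exact: archi_boundP.
Qed.

(** Bernoulli's inequality, the tangent at 1, makes a power of 1 + x at least 4; the same power of
    (1 - x)(1 + x) is at most 1. *)
Lemma exists_pow_le_quarter (R : archiRealFieldType) (x : R) : 0 < x -> x <= 1 ->
  exists q : nat, (1 - x) ^+ q <= 4^-1.
Proof.
move=> x0 x1; have [N HN] := exists_nat_gt (4 / x); exists N.+1.
have h1 : 4 <= (1 + x) ^+ N.+1.
  apply: le_trans (tangent_pow N ler01 (_ : 0 <= 1 + x)); last by lra.
  rewrite !expr1n mulr1 [1 + x]addrC addrK.
  move: HN; rewrite ltr_pdivrMr // -natr1; nra.
have h2 : (1 - x) ^+ N.+1 * (1 + x) ^+ N.+1 <= 1.
  by rewrite -exprMn exprn_ile1 //; nra.
have h3 : 0 <= (1 - x) ^+ N.+1 by rewrite exprn_ge0 // subr_ge0.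
have := ler_wpM2l h3 h1; lra.
Qed.

Theorem theorem1p1 (R : realType) (k m : nat) (eps alpha : R)
  (hk : (3 <= k)%N) (hm : (1 <= m)%N)
  (heps : 0 < eps < 1) (halpha : 0 < alpha < 1)
  (TF : finType) (partF : TF -> 'I_k) (EF : {set {set TF}})
  (hF : is_kpartite_kgraph partF EF) (hFm : parts_of_size partF m) :
  exists (n0 : nat) (mu : R), 0 < mu /\
    forall n : nat, (n0 <= n)%N -> (m %| n)%N ->
    forall (T : finType) (part : T -> 'I_k) (E : {set {set T}}),
      is_kpartite_kgraph part E ->
      parts_of_size part n ->
      pmu_dense part E (1 / 2 + eps) mu ->
      partite_mindeg_ge part E (k - 1) (alpha * n%:R) ->
      has_F_factor EF E.
Proof.
have /andP[eps0 _] := heps; have /andP[alpha0 _] := halpha.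
have k1 : (1 < k)%N by apply: leq_trans hk.
have k0 := ltnW k1.
pose kap : R := k%:R^-1; have kap0 : 0 < kap by rewrite invr_gt0 ltr0n ltnW.
pose c1 := nbr_const k alpha; have c10 : 0 < c1 / 2 by rewrite divr_gt0 ?nbr_const_gt0.
pose b := absorb_size k m.
pose beta := Num.min (absorb_const k m eps alpha) 1.
have beta0 : 0 < beta by rewrite lt_min (absorb_const_gt0 m k0 eps0 alpha0) ltr01.
have beta1 : beta <= 1 by rewrite ge_min lexx orbT.
have [q qP] : exists q : nat, (1 - beta / 4) ^+ q <= 4^-1.
  by apply: exists_pow_le_quarter; lra.
(* With at most n/D for [h], the [q * h] absorbers of size [b] occupy so few vertices that a random
   absorber hits them with probability at most [beta / 4]. *)
have [D DP] := exists_nat_gt (4 * b%:R ^+ 2 * q%:R / beta).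
have D0 : (0 < D)%N.
  rewrite -(ltr0n R); apply: le_lt_trans DP.
  by rewrite divr_ge0 ?(ltW beta0) // !mulr_ge0 ?exprn_ge0 ?ler0n.
pose rho := (kap / D%:R) ^+ k.
have rho0 : 0 < rho by rewrite exprn_gt0 // divr_gt0 ?ltr0n.
pose mu1 := eps * kap ^+ k.
pose mu2 := eps * kap ^+ k.-1 * (c1 / 2) ^+ 2.
have mu10 : 0 < mu1 by rewrite mulr_gt0 ?exprn_gt0.
have mu20 : 0 < mu2 := mulr_gt0 (mulr_gt0 eps0 (exprn_gt0 _ kap0)) (exprn_gt0 2 c10).
(* The three bounds serve the density of tiles, the density of swaps, and tiles inside the uncovered
   set. *)
pose mu := Num.min mu1 (Num.min (mu2 / 2) (rho / 4)).
have mu0 : 0 < mu by rewrite !lt_min mu10 !divr_gt0.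
have [h0 h0P] := poly_lt_exp (k * D) (k * m).
have [n1 n1P] := exists_nat_gt (4 * b%:R ^+ 2 / beta).
have [n2 n2P] := exists_nat_gt ((k * m)%:R ^+ 2 / (rho / 4) ^+ (m ^ k)).
(* The first summand makes n positive and n/D at least [h0]; [n1] and [n2] make repeated letters
   rare in absorbers and in tiles. *)
exists ((D * h0).+1 + n1 + n2)%N, mu; split=> // n nn mn T part E kE pE dE cE.
have n0 : (0 < n)%N by apply: leq_trans nn.
have [nh nn1 nn2] : [/\ (D * h0 <= n)%N, (n1 <= n)%N & (n2 <= n)%N].
  by clear -nn; split; lia.
have [x0 _] : exists x : T, true.
  have := forallP pE (Ordinal (ltnW k1)); rewrite -(prednK n0) => /eqP H.
  have /card_gt0P[x _] : (0 < #|[set x | part x == Ordinal (ltnW k1)]|)%N by rewrite H.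
  by exists x.
have cT : #|T| = (k * n)%N := card_T pE.
have nT : n%:R <= #|T|%:R :> R by rewrite ler_nat cT leq_pmull // ltnW.
have T0 : 0 < #|T|%:R :> R by apply: lt_le_trans nT; rewrite ltr0n.
(* This [h] is both the largest number of groups left to absorb and the number of absorbers that
   each group exceeds. *)
pose h := (n %/ D)%N.
have hD : (h * D <= n)%N by rewrite leq_trunc_div.
have nD : (n <= D * h.+1)%N by rewrite mulnC ltnW // ltn_ceil.
have n1n : n1%:R <= n%:R :> R by rewrite ler_nat.
have n2n : n2%:R <= n%:R :> R by rewrite ler_nat.
apply: (tiled_has_F_factor (x0 := x0) (m := m) (part := part) hm hF hFm).
apply: (@absorb_and_cover R k m n T part E x0 k1 hm n0 kE pE eps alpha mu
  eps0 alpha0 (ltW mu0) dE cE D D0 _ _ beta q h) => //.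
- by rewrite !ge_min lexx !orbT.
- rewrite ltr_pdivrMr ?ltr0n // mulrC -ltr_pdivrMr; last by rewrite exprn_gt0 // divr_gt0.
  exact: lt_le_trans n2P n2n.
- by rewrite ge_min lexx.
- by rewrite ge_min lexx.
- have : mu <= mu2 / 2 by rewrite !ge_min lexx !orbT.
  rewrite /mu2 /c1 /kap; lra.
- rewrite ler_pdivrMr //; move: n1P; rewrite ltr_pdivrMr // -/b.
  have := ler_wpM2r (ltW beta0) (le_trans n1n nT); lra.
- rewrite mulrA ler_pdivrMr // -/b !natrM.
  move: DP; rewrite ltr_pdivrMr // => DP.
  have hDn : h%:R * D%:R <= n%:R :> R by rewrite -natrM ler_nat.
  have e1 := ler_wpM2l (ler0n R h) (ltW DP).
  have e2 := ler_wpM2r (ltW beta0) (le_trans hDn nT).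
  rewrite expr2 in e1; lra.
- apply: leq_ltn_trans (h0P h _).
    by rewrite cT leq_exp2r ?muln_gt0 ?hm ?andbT ?(ltnW k1) // -mulnA leq_mul2l nD orbT.
  by rewrite leq_divRL // mulnC.
Qed.
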